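(* Let $1\leqslant p\leqslant\infty$. (i) For $0<\xi\leqslant\omega_1$, $\mathfrak{NP}_p^\xi\subsetneq\mathfrak{SM}_p^\xi$. (ii) For every ordinal $\xi>0$, $\mathfrak{SM}_p^1\not\subset\mathfrak{NP}_p^\xi$.
   Context: ''Operator'' means bounded linear operator between Banach spaces; $B_X$ is the closed unit ball. $(u_i)\lesssim_K(v_i)$ means $\|\sum a_iu_i\|\leqslant K\|\sum a_iv_i\|$ for all (finitely supported) scalars. Let $(e_i)$ be the canonical basis of $\ell_p$ ($c_0$ if $p=\infty$). A tree $T$ on a set is a set of finite sequences (the empty sequence allowed) closed under initial segments. $T'$ is $T$ minus its maximal members; $T^0=T$, $T^{\xi+1}=(T^\xi)'$, $T^\xi=\bigcap_{\zeta<\xi}T^\zeta$ for limit $\xi$; $o(T)$ is the least ordinal $\xi$ with $T^\xi=\varnothing$, or $\infty$ (larger than all ordinals) if there is none. For $A:X\to Y$ and $K\geqslant1$, $T_p(A,X,Y,K)$ is the tree of finite sequences $(x_i)_{i=1}^n$ in $B_X$ with $(x_i)_{i=1}^n\lesssim_1(e_i)_{i=1}^n$ and $(e_i)_{i=1}^n\lesssim_K(Ax_i)_{i=1}^n$; $\mathbf{NP}_p(A,X,Y)=\sup_{K\geqslant1}o(T_p(A,X,Y,K))$; $\mathfrak{NP}_p^\xi$ is the class of all operators $A:X\to Y$ with $\mathbf{NP}_p(A,X,Y)\leqslant\omega^\xi$. Schreier families: for finite $E,F\subset\mathbb N$, $E<F$ means $\max E<\min F$, and $n\leqslant E$ means $n\leqslant\min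 E$. $\mathcal F[\mathcal G]=\{\bigcup_{i=1}^nE_i:E_1<\dots<E_n,\ (\min E_i)_{i=1}^n\in\mathcal F,\ E_i\in\mathcal G\}$; $\mathcal S=\{E:|E|\leqslant\min E\}\cup\{\varnothing\}$; $\mathcal S_0=\{\varnothing\}\cup\{\{n\}:n\in\mathbb N\}$; $\mathcal S_{\xi+1}=\mathcal S[\mathcal S_\xi]$; for a countable limit $\xi$ fix successors $\xi_n\uparrow\xi$ with $\mathcal S_{\xi_n}\subset\mathcal S_{\xi_{n+1}}$ and let $\mathcal S_\xi=\{E:\exists n\leqslant E,\ E\in\mathcal S_{\xi_n}\}\cup\{\varnothing\}$; $\mathcal S_{\omega_1}$ is the family of all finite subsets of $\mathbb N$. For $0<\xi\leqslant\omega_1$, $(x_i)$ is an $\ell_p^\xi$ ($c_0^\xi$ if $p=\infty$) spreading model if for some $a,b>0$, $(e_i)_{i\in E}\lesssim_a(x_i)_{i\in E}$ and $(x_i)_{i\in E}\lesssim_b(e_i)_{i\in E}$ for all $E\in\mathcal S_\xi$. $\mathfrak{SM}_p^\xi$ is the class of all operators $A:X\to Y$ such that whenever $(x_n)\subset X$ is an $\ell_p^\xi$ ($c_0^\xi$) spreading model, $(Ax_n)$ is not one. *)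

(* Defs.v *)
From HB Require Import structures.
From mathcomp Require Import all_boot all_order all_algebra finmap.
From mathcomp Require Import all_classical all_reals all_analysis.
From mathcomp Require Import complex.
Set Implicit Arguments.
Unset Strict Implicit.
Unset Printing Implicit Defensive.
Import Order.TTheory GRing.Theory Num.Theory numFieldNormedType.Exports.
Local Open Scope classical_set_scope.
Local Open Scope ring_scope.

(* Ordinals, presented as terms built from 0, successors and suprema of
   nonempty small families.  Several terms may denote the same ordinal, so
   ordinals are compared with [ole], [olt] and [oeq], never with [=].  The
   point [I] in [osup] makes the family nonempty; this is what makes the
   usual limit clauses of the recursive definitions below correct for every
   [osup], including those whose value is not a limit ordinal. *)
Inductive ord : Type :=
| ozero
| osucc (x : ord)
| osup (I : Type) (i0 : I) (f : I -> ord).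

Fixpoint ole (x : ord) : ord -> Prop :=
  match x with
  | ozero => fun=> True
  | osucc x' => fix succ_le (y : ord) : Prop :=
      match y with
      | ozero => False
      | osucc y' => ole x' y'
      | osup _ _ g => exists j, succ_le (g j)
      end
  | osup _ _ f => fun y => forall i, ole (f i) y
  end.

Definition olt (x y : ord) : Prop := ole (osucc x) y.
Definition oeq (x y : ord) : Prop := ole x y /\ ole y x.

Fixpoint oadd (x y : ord) : ord :=
  match y with
  | ozero => x
  | osucc y' => osucc (oadd x y')
  | osup _ i0 f => osup i0 (fun i => oadd x (f i))
  end.

Fixpoint omul (x y : ord) : ord :=
  match y with
  | ozero => ozero
  | osucc y' => oadd (omul x y') x
  | osup _ i0 f => osup i0 (fun i => omul x (f i))
  end.

Definition oone : ord := osucc ozero.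
Definition omega : ord := osup 0%N (fun n => iter n osucc ozero).

(* omega to the power x *)
Fixpoint omega_pow (x : ord) : ord :=
  match x with
  | ozero => oone
  | osucc x' => omul (omega_pow x') omega
  | osup _ i0 f => osup i0 (fun i => omega_pow (f i))
  end.

(* Terms for the countable ordinals: only sequences are allowed in suprema. *)
Inductive countable_ord : Type :=
| czero
| csucc (x : countable_ord)
| csup (f : nat -> countable_ord).

Fixpoint ord_of_countable (x : countable_ord) : ord :=
  match x with
  | czero => ozero
  | csucc x' => osucc (ord_of_countable x')
  | csup f => osup 0%N (fun n => ord_of_countable (f n))
  end.

(* the first uncountable ordinal *)
Definition omega1 : ord := osup czero ord_of_countable.

Definition is_succ (x : ord) : Prop := exists y, oeq x (osucc y).
Definition is_limit (x : ord) : Prop := ~ oeq x ozero /\ ~ is_succ x.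

(* Ordinals together with [None], the symbol oo larger than all ordinals *)
Definition eord : Type := option ord.

Definition eole (x y : eord) : Prop :=
  match x, y with
  | _, None => True
  | None, Some _ => False
  | Some x', Some y' => ole x' y'
  end.

Definition eosup (I : Type) (i0 : I) (f : I -> eord) : eord :=
  if pselect (forall i, f i <> None)
  then Some (osup i0 (fun i => odflt ozero (f i))) else None.

Section Trees.
Variable X : eqType.

Definition maximal_in (T : set (seq X)) (s : seq X) : Prop :=
  T s /\ forall t, T t -> prefix s t -> t = s.

Definition tree_deriv (T : set (seq X)) : set (seq X) :=
  T `\` maximal_in T.

(* The iterated derivatives decrease, so the intersection over a family with
   supremum x is the intersection over all ordinals below x when x is a
   limit, and is the derivative of order x when the supremum is attained. *)
Fixpoint tree_deriv_iter (T : set (seq X)) (x : ord) : set (seq X) :=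
  match x with
  | ozero => T
  | osucc x' => tree_deriv (tree_deriv_iter T x')
  | osup _ _ f => \bigcap_i tree_deriv_iter T (f i)
  end.

Definition least_vanishing (T : set (seq X)) (x : ord) : Prop :=
  tree_deriv_iter T x = set0 /\
  forall y, tree_deriv_iter T y = set0 -> ole x y.

Definition tree_order (T : set (seq X)) : eord :=
  match pselect (exists x, least_vanishing T x) with
  | left h => Some (projT1 (cid h))
  | right _ => None
  end.

End Trees.

(* The natural numbers of the Schreier families are 1, 2, 3, ...: the
   families consist of finite sets of positive integers. *)
Definition fset_min (E : {fset nat}) : nat := head 0%N (sort leq E).
Definition fset_max (E : {fset nat}) : nat := last 0%N (sort leq E).

Definition fset_before (E F : {fset nat}) : bool :=
  (fset_max E < fset_min F)%N.

Definition schreier_prod (F G : set {fset nat}) : set {fset nat} :=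
  [set E | exists Es : seq {fset nat},
    [/\ all (fun D => D != fset0) Es,
        sorted fset_before Es,
        F [fset n in map fset_min Es]%fset,
        forall D, D \in Es -> G D
      & E = (\bigcup_(D <- Es) D)%fset]].

Definition schreier : set {fset nat} :=
  [set E | (#|` E| <= fset_min E)%N] `|` [set fset0].

Definition schreier0 : set {fset nat} :=
  [set fset0] `|` [set E | exists2 n, (0 < n)%N & E = [fset n]%fset].

(* [S] is a transfinite sequence of Schreier families, for some choice of
   the sequences used at countable limit ordinals.  There [xs n] stands for
   the (n+1)-st term of the sequence, and [n < min E] for n + 1 <= E. *)
Record schreier_families (S : ord -> set {fset nat}) : Prop := {
  schreier_ext : forall x y, oeq x y -> S x = S y;
  schreier_zero : S ozero = schreier0;
  schreier_succ : forall x, olt x omega1 ->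
    S (osucc x) = schreier_prod schreier (S x);
  schreier_limit : forall x, is_limit x -> olt x omega1 ->
    exists xs : nat -> ord,
      [/\ forall n, is_succ (xs n),
          forall n, olt (xs n) (xs n.+1),
          oeq x (osup 0%N xs),
          forall n, S (xs n) `<=` S (xs n.+1)
        & S x = [set E | exists2 n, (n < fset_min E)%N & S (xs n) E]
                `|` [set fset0]];
  schreier_omega1 : S omega1 = [set E : {fset nat} | 0%N \notin E]
}.

(* The scalar field is either R or R[i].  Norms in a normed module over R[i]
   are valued in R[i] (with zero imaginary part); [rnorm] is the real-valued
   norm. *)
Variant scalar_kind := RealScalars | ComplexScalars.

Section Scalars.
Variables (R : realType) (k : scalar_kind).

Definition scalar_field : numFieldType :=
  match k with RealScalars => R : numFieldType
             | ComplexScalars => R[i] : numFieldType end.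

Definition scalar_re : scalar_field -> R :=
  match k return (match k with RealScalars => R : numFieldType
             | ComplexScalars => R[i] : numFieldType end) -> R with
  | RealScalars => fun a => a
  | ComplexScalars => fun a => complex.Re a
  end.

Definition rnorm (X : normedModType scalar_field) (x : X) : R := scalar_re `|x|.

Definition scalar_abs (a : scalar_field) : R := scalar_re `|a|.

Record operator (X Y : completeNormedModType scalar_field) := Operator {
  operator_fun :> {linear X -> Y};
  operator_bounded : bounded_near operator_fun (nbhs (0 : X))
}.

Definition operator_class : Type :=
  forall X Y : completeNormedModType scalar_field, operator X Y -> Prop.

Definition subclass (C D : operator_class) : Prop :=
  forall X Y (A : operator X Y), C X Y A -> D X Y A.

Definition proper_subclass (C D : operator_class) : Prop :=
  subclass C D /\ ~ subclass D C.

Section FixedExponent.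
Variable p : \bar R.

(* Given finitely many distinct indices E and scalars c, [comb_norm x E c]
   is the norm of the sum over i in E of c_i x_i, and [lp_norm E c] is the
   norm of the sum over i in E of c_i e_i in l_p (in c_0 when p = +oo). *)
Definition comb_norm (X : normedModType scalar_field) (x : nat -> X)
  (E : seq nat) (c : nat -> scalar_field) : R := rnorm (\sum_(i <- E) c i *: x i).

Definition lp_norm (E : seq nat) (c : nat -> scalar_field) : R :=
  match p with
  | r%:E => (\sum_(i <- E) scalar_abs (c i) `^ r) `^ r^-1
  | _ => \big[Num.max/0]_(i <- E) scalar_abs (c i)
  end.

(* (u_i)_(i in E) <~_K (v_i)_(i in E), with [N] and [M] the norms of the
   linear combinations of (u_i) and of (v_i) *)
Definition dominated (E : seq nat) (K : R)
  (N M : seq nat -> (nat -> scalar_field) -> R) : Prop :=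
  forall c : nat -> scalar_field, N E c <= K * M E c.

Definition lp_tree (X Y : completeNormedModType scalar_field) (A : operator X Y)
  (K : R) : set (seq X) :=
  [set s : seq X | [/\ forall x : X, x \in s -> rnorm x <= 1,
      dominated (iota 0 (size s)) 1 (comb_norm (nth 0 s)) lp_norm
    & dominated (iota 0 (size s)) K lp_norm
        (comb_norm (fun i => A (nth 0 s i)))]].

Definition NP_index (X Y : completeNormedModType scalar_field) (A : operator X Y) :
  eord :=
  eosup (exist (fun K : R => 1 <= K) 1 (lexx 1))
    (fun K => tree_order (lp_tree A (sval K))).

Definition NP_class (x : ord) : operator_class :=
  fun X Y A => eole (NP_index A) (Some (omega_pow x)).

(* Only the positive indices matter: sequences are (u_n) for n >= 1, and the
   value [u 0] is never used since Schreier sets do not contain 0. *)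
Definition spreading_model (F : set {fset nat})
  (X : completeNormedModType scalar_field) (u : nat -> X) : Prop :=
  exists a b : R, [/\ 0 < a, 0 < b &
    forall E : {fset nat}, F E ->
      dominated E a lp_norm (comb_norm u) /\
      dominated E b (comb_norm u) lp_norm].

Definition SM_class (F : set {fset nat}) : operator_class :=
  fun X Y A => forall u : nat -> X,
    spreading_model F u -> ~ spreading_model F (fun n => A (u n)).

End FixedExponent.
End Scalars.

(* Main.v *)
From HB Require Import structures.
Require Import Defs.
From mathcomp Require Import all_boot all_order all_algebra finmap.
From mathcomp Require Import all_classical all_reals all_analysis.
From mathcomp Require Import complex ring lra.

(** Inclusion. Suppose that [u] and its image under [A] are both l_p^xi
    spreading models. After one rescaling of [u], every member of the Schreier
    family S_xi becomes a node of a single tree T_p(A, X, Y, K)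
    ([spreading_model_tree]). For countable xi the family S_xi, seen as a tree
    of increasing sequences, has rank larger than omega^xi ([schreier_rank]):
    S_(xi+1) contains, beyond n, all unions of n successive members of S_xi,
    hence has rank at least omega^xi * n for every n. For xi = omega_1 the
    tree of all finite sets is ill-founded. So the index of [A] exceeds
    omega^xi ([NP_class_sub_SM_class]).

    Strictness. Since S_1 is contained in S_xi, it is enough to produce, for
    every ordinal, an operator in the class SM_p^1 of larger index
    ([SM_class1_sub]). Take a well-founded tree [P] of rank at least omega^xi,
    the decreasing sequences of ordinals below omega^xi. Let X be the space of
    functions on [P] with the largest norm for which every branch (the
    prefixes of a node) spans a space whose norm is at most that of l_p, and
    let Y carry the supremum over the branches of the l_p norm along the
    branch. The inclusion of X into Y has norm at most 1, and on each branch
    it is an isometry between copies of finite dimensional l_p spaces. Hence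
    [P] embeds in T_p(A, X, Y, 1) ([tree_operator_not_NP]). Both norms are
    given by families of finitely supported weights. This makes completeness
    elementary, and X becomes an iterated sum: the subtrees of the immediate
    successors of a node are l_1-independent.

    If p > 1, the space X itself has no l_p^1 spreading model. Long sums of a
    spreading model with p > 1 are small in Cesàro mean. By induction along
    the tree such a sequence tends to 0 in norm, exactly as l_1-sums inherit
    the Schur property ([cesaro_null_norm]).

    If p = 1, then X is l_1 over the nodes of [P]. A bounded sequence has a
    pointwise limit along a free ultrafilter; subtracting it leaves functions
    that are bounded in l_1 and tend to 0 at every node. As [P] has no
    infinite branch, there are long finite sets of indices such that on each
    branch at most one of the corresponding functions is heavy
    ([ultra_not_both_heavy], [sparse_indices]). Alternating sums over such a
    set remove the limit and are small in Y, against a lower l_1 estimate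
    ([tree_operator_SM1]). *)

Set Implicit Arguments.
Unset Strict Implicit.
Unset Printing Implicit Defensive.
Import Order.TTheory GRing.Theory Num.Theory numFieldNormedType.Exports.
Local Open Scope classical_set_scope.
Local Open Scope ring_scope.

(** * Ordinal terms *)

Lemma ole_osup_r x I (i0 : I) f i : ole x (f i) -> ole x (osup i0 f).
Proof.
elim: x => [|x IH|J j0 g IH] //=; first by exists i.
by move=> H j; apply: IH.
Qed.

Lemma ole_refl x : ole x x.
Proof. by elim: x => //= I i0 f IH i; apply: ole_osup_r (IH i). Qed.

Lemma ole_trans y x z : ole x y -> ole y z -> ole x z.
Proof.
elim: y x z => [|y IHy|I i0 f IH] x z.
- elim: x => //= J j0 g IHg h _ i; exact: IHg (h i) _.
- elim: x => [|x _|J j0 g IHg] //.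
  + move=> /= xy; elim: z => [|z _|J j0 g IHg] //=; first exact: IHy.
    by move=> [j hj]; exists j; apply: IHg.
  + by move=> h yz i; exact: (IHg i (h i) yz).
- elim: x => [|x _|J j0 g IHg] //.
  + by move=> [i hi] hz; exact: (IH i (osucc x) z hi (hz i)).
  + by move=> h hz i; exact: (IHg i (h i) hz).
Qed.

Lemma ole_succ x : ole x (osucc x).
Proof.
elim: x => //= I i0 f IH i.
exact: (@ole_trans (osucc (f i)) _ (osucc (osup i0 f)) (IH i) (@ole_osup_r (f i) I i0 f i (ole_refl _))).
Qed.

Lemma oltW x y : olt x y -> ole x y.
Proof. by move=> h; apply: ole_trans (ole_succ x) h. Qed.

Lemma ole_or_olt x y : ole x y \/ olt y x.
Proof.
elim: x y => [|x IHx|I i0 f IH] y; first by left.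
- elim: y => [|y _|J j0 g IHg]; first by right.
  + by case: (IHx y) => h; [left|right].
  + have [[j hj]|h] := pselect (exists j, ole (osucc x) (g j)).
      by left; exists j.
    right => j; case: (IHg j) => // hj; by case: h; exists j.
- have [h|/existsNP[i hi]] := pselect (forall i, ole (f i) y); first by left.
  by right; case: (IH i y) => // h; exists i.
Qed.

Lemma olt_ole_trans x y z : olt x y -> ole y z -> olt x z.
Proof. by rewrite /olt => xy; exact: ole_trans xy. Qed.

Lemma olt_wf : well_founded olt.
Proof.
move=> x; constructor; elim: x => [|x IH|I i0 f IH] y.
- by case.
- rewrite /olt /= => yx; constructor=> z zy.
  by apply: IH; apply: (olt_ole_trans zy yx).
- by move=> [j]; apply: IH.
Qed.

Lemma ord_cases x :
  [\/ oeq x ozero, exists y, oeq x (osucc y) | is_limit x].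
Proof.
have [h|h] := pselect (oeq x ozero); first by constructor 1.
have [h'|h'] := pselect (is_succ x); first by constructor 2.
by constructor 3.
Qed.

Lemma oadd_mono x x' y y' :
  ole x x' -> ole y y' -> ole (oadd x y) (oadd x' y').
Proof.
move=> xx'.
have h0 z : ole x (oadd x' z).
  elim: z => [|z IH|J j0 g IH] //=; first exact: ole_trans IH (ole_succ _).
  exact: ole_osup_r (IH j0).
elim: y y' => [|y IHy|I i0 f IH] y' //.
- elim: y' => [|y' _|J j0 g IHg] //=; first exact: IHy.
  by move=> [j hj]; exists j; apply: IHg.
- by move=> h i; apply: IH.
Qed.

Lemma omul_monol x x' y : ole x x' -> ole (omul x y) (omul x' y).
Proof.
move=> xx'; elim: y => [|y IHy|I i0 f IH] //=; first exact: oadd_mono.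
by move=> i; apply: ole_osup_r (IH i).
Qed.

Lemma omega_pow_mono x y : ole x y -> ole (omega_pow x) (omega_pow y).
Proof.
have h0 z : ole oone (omega_pow z).
  elim: z => [|z IHz|J j0 g IH] //=.
    exists 1%N; change (ole oone (oadd ozero (omega_pow z))).
    exact: (@ole_trans (oadd ozero oone) oone _ _ (oadd_mono _ IHz)).
  by exists j0; apply: IH.
elim: x y => [|x IHx|I i0 f IH] y; first by move=> _; apply: h0.
- elim: y => [|y _|J j0 g IHg] //.
  + by move=> xy; apply: omul_monol; apply: IHx.
  + by move=> [j hj]; apply: ole_trans (IHg j hj) _; apply: ole_osup_r (ole_refl _).
- by move=> h i; apply: IH.
Qed.

(** * Derivatives of trees *)

Section TreeDerivatives.
Variable X : eqType.
Implicit Types (T P : set (seq X)) (s t : seq X).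

Lemma tree_deriv_sub T : tree_deriv T `<=` T.
Proof. by move=> s []. Qed.

Lemma tree_derivP T s :
  tree_deriv T s <-> T s /\ exists2 t, T t & prefix s t /\ t <> s.
Proof.
split=> [[Ts hm]|[Ts [t Tt [st ts]]]].
  split=> //; apply: contrapT => h; apply: hm; split=> // t Tt st.
  by apply: contrapT => ts; apply: h; exists t.
by split=> // -[_ /(_ t Tt st)].
Qed.

Lemma tree_deriv_mono T P : P `<=` T -> tree_deriv P `<=` tree_deriv T.
Proof.
move=> PT s /tree_derivP[Ps [t Pt h]]; apply/tree_derivP.
by split; [exact: PT|exists t => //; exact: PT].
Qed.

Lemma tree_deriv_iter_mono T P x :
  P `<=` T -> tree_deriv_iter P x `<=` tree_deriv_iter T x.
Proof.
move=> PT; elim: x => [|x IH|I i0 f IH] //=; first exact: tree_deriv_mono.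
by move=> s h i _; apply: IH; apply: h.
Qed.

Lemma tree_deriv_iter_sub T x : tree_deriv_iter T x `<=` T.
Proof.
elim: x => [|x IH|I i0 f IH] //=; first by move=> s /tree_deriv_sub/IH.
by move=> s /(_ i0 Logic.I)/IH.
Qed.

Lemma tree_deriv_iter_anti T x y :
  ole x y -> tree_deriv_iter T y `<=` tree_deriv_iter T x.
Proof.
elim: x y => [|x IHx|I i0 f IH] y.
- by move=> _; apply: tree_deriv_iter_sub.
- elim: y => [|y _|J j0 g IHg] //.
  + by move=> /= xy; apply: tree_deriv_mono; apply: IHx.
  + by move=> [j hj] s h; apply: (IHg j hj); apply: h.
- by move=> h s ys i _; apply: (IH i _ (h i)).
Qed.

Lemma tree_deriv_iter_add T x y :
  tree_deriv_iter T (oadd x y) = tree_deriv_iter (tree_deriv_iter T x) y.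
Proof.
elim: y => [|y IH|I i0 f IH] //=; first by rewrite IH.
by apply: eq_bigcapr => i _; rewrite IH.
Qed.

Lemma tree_deriv_iter_nil T t x :
  T [::] -> tree_deriv_iter T x t -> tree_deriv_iter T x [::].
Proof.
move=> T0; elim: x t => [|x IH|I i0 f IH] //= t.
- move=> xt; have /IH x0 := tree_deriv_sub xt.
  have [<-//|t0] := pselect (t = [::]).
  apply/tree_derivP; split=> //; exists t; first exact: tree_deriv_sub xt.
  by rewrite prefix0s.
- by move=> h i _; apply: (IH i t); apply: h.
Qed.

(** No member is ever maximal, so deriving never removes anything. This
    covers the ill-founded tree of all finite sets. *)
Lemma tree_deriv_iter_perfect T x :
  (forall s, T s -> exists2 t, T t & prefix s t /\ t <> s) ->
  T `<=` tree_deriv_iter T x.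
Proof.
move=> h; elim: x => [|x IH|I i0 f IH] //=; last by move=> s Ts i _; apply: IH.
move=> s Ts; apply/tree_derivP; split; first exact: IH.
by have [t Tt ?] := h s Ts; exists t => //; apply: IH.
Qed.

End TreeDerivatives.

(** Strict extensions witness non-maximality, so a map preserving them
    carries each derivative into the derivative of the same order. Lower
    bounds on orders are obtained by mapping trees of known rank. *)
Lemma tree_deriv_iter_image (X Z : eqType) (h : seq X -> seq Z)
    (P : set (seq X)) (T : set (seq Z)) x :
  (forall s t, P s -> P t -> prefix s t -> t <> s ->
     prefix (h s) (h t) /\ h t <> h s) ->
  (forall s, P s -> T (h s)) ->
  forall s, tree_deriv_iter P x s -> tree_deriv_iter T x (h s).
Proof.
move=> hh hPT; elim: x => [|x IH|I i0 f IH] //= s.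
- move=> /tree_derivP[Ps [t Pt [st ts]]]; apply/tree_derivP.
  split; first exact: IH.
  exists (h t); first exact: IH.
  by apply: hh => //; [exact: tree_deriv_iter_sub Ps|exact: tree_deriv_iter_sub Pt].
- by move=> H i _; apply: IH; apply: H.
Qed.

(** The derivatives decrease, so one that still contains the empty sequence
    comes strictly before the first empty one. *)
Lemma tree_order_gt (X : eqType) (T : set (seq X)) x :
  tree_deriv_iter T x [::] -> ~ eole (tree_order T) (Some x).
Proof.
move=> T0; rewrite /tree_order; case: pselect => [h|_] /=; last by case.
case: (cid h) => z [hz _] /= zx.
by have := tree_deriv_iter_anti zx T0; rewrite hz.
Qed.

(** * Rank of the Schreier families *)

Section FsetOfSeq.
Implicit Types (s : seq nat).

Lemma sort_fset_of_seq s : sorted ltn s -> sort leq [fset n in s]%fset = s.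
Proof.
move=> ss; apply: (irr_sorted_eq ltn_trans ltnn) => //.
- rewrite ltn_sorted_uniq_leq sort_uniq fset_uniq /=.
  by apply: sort_sorted; apply: leq_total.
- by move=> n; rewrite mem_sort !inE.
Qed.

Lemma fset_min_of_seq s : sorted ltn s -> fset_min [fset n in s]%fset = head 0%N s.
Proof. by move=> ss; rewrite /fset_min sort_fset_of_seq. Qed.

Lemma fset_max_of_seq s : sorted ltn s -> fset_max [fset n in s]%fset = last 0%N s.
Proof. by move=> ss; rewrite /fset_max sort_fset_of_seq. Qed.

Lemma fset_min_mem (E : {fset nat}) : E != fset0 -> fset_min E \in E.
Proof.
move=> E0; rewrite /fset_min -(mem_sort leq).
case e: (sort leq E) => [|a l]; last by rewrite mem_head.
case/eqP: E0; apply/fsetP => n.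
by have := mem_sort leq E n; rewrite e !inE => <-.
Qed.

Lemma fset_of_seq_nil : [fset n in ([::] : seq nat)]%fset = fset0.
Proof. by apply/fsetP => n; rewrite !inE. Qed.

Lemma fset_of_seq_eq0 s : ([fset n in s]%fset == fset0) = (s == [::]).
Proof.
case: s => [|a s]; first by rewrite fset_of_seq_nil eqxx.
by apply/eqP => /fsetP /(_ a); rewrite !inE eqxx.
Qed.

Lemma fset_of_seq_flatten (ss : seq (seq nat)) :
  [fset n in flatten ss]%fset =
  (\bigcup_(D <- [seq [fset n in b]%fset | b <- ss]) D)%fset.
Proof.
elim: ss => [|b ss IH] /=; first by rewrite big_nil fset_of_seq_nil.
by rewrite big_cons -IH; by apply/fsetP => n; rewrite !inE.
Qed.

Lemma card_fset_of_seq s : (#|` [fset n in s]%fset| <= size s)%N.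
Proof.
apply: uniq_leq_size; first exact: fset_uniq.
by move=> n; rewrite !inE.
Qed.

End FsetOfSeq.

Lemma sorted_ltn_flatten_before (ss : seq (seq nat)) :
  sorted ltn (flatten ss) -> all (fun b => b != [::]) ss ->
  sorted fset_before [seq [fset n in b]%fset | b <- ss].
Proof.
elim: ss => [|b [|b' ss] IH] //= hs /and3P[b0 b'0 nss].
have [hb hr] := cat_sorted2 hs.
have [hb' _] := cat_sorted2 hr.
rewrite [X in X && _](_ : _ = true).
  by apply: IH; rewrite //= b'0.
rewrite /fset_before fset_max_of_seq // fset_min_of_seq //.
case: b b0 hs hb => // a b _; case: b' b'0 {hr hb' IH} => // a' b' _ /=.
by rewrite cat_path /= => /and3P[].
Qed.

Section SchreierRank.
Variables (S : ord -> set {fset nat}) (hS : schreier_families S).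

(** Only the sets with minimum at least [N] are kept: the induction on [x]
    needs the rank of every final segment of the family. *)
Definition schreier_tree (x : ord) (N : nat) : set (seq nat) :=
  [set s | [/\ sorted ltn s, all (leq N) s & S x [fset n in s]%fset]].

(** Increasing lists of elements at least [N] that split into at most [m]
    successive members of [S x]. For [m <= N] these are members of
    [S (osucc x)]. *)
Definition block_tree (x : ord) (N m : nat) : set (seq nat) :=
  [set s | exists2 ss, s = flatten ss &
    [/\ (size ss <= m)%N, all (fun b => b != [::]) ss,
        forall b, b \in ss -> S x [fset n in b]%fset,
        sorted ltn s & all (leq N) s]].

Lemma block_tree_schreier_tree x N m : (0 < m <= N)%N -> olt x omega1 ->
  block_tree x N m `<=` schreier_tree (osucc x) N.
Proof.
move=> /andP[m0 mN] xw s [ss def_s [szm ne Sb hs hN]].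
split=> //; rewrite (schreier_succ hS) //.
exists [seq [fset n in b]%fset | b <- ss]; split.
- by rewrite all_map; apply: sub_all ne => b /=; rewrite fset_of_seq_eq0.
- by apply: sorted_ltn_flatten_before => //; rewrite -def_s.
- rewrite -map_comp; set l := map _ ss.
  have [l0|l0] := eqVneq l [::].
    by right; rewrite /= l0 fset_of_seq_nil.
  left; rewrite /=.
  have lN : (N <= fset_min [fset n in l]%fset)%N.
    have := @fset_min_mem [fset n in l]%fset.
    rewrite fset_of_seq_eq0 => /(_ l0); rewrite !inE => /mapP[b bss ->] /=.
    have b0 := allP ne _ bss.
    have := @fset_min_mem [fset n in b]%fset.
    rewrite fset_of_seq_eq0 => /(_ b0); rewrite !inE => hb.
    by apply: (allP hN); rewrite def_s; apply/flattenP; exists b.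
  apply: leq_trans lN; apply: leq_trans mN; apply: leq_trans szm.
  by apply: leq_trans (card_fset_of_seq _) _; rewrite size_map.
- by move=> D /mapP[b bss ->]; apply: Sb.
- by rewrite def_s fset_of_seq_flatten.
Qed.

(** One more admissible block contributes omega ^ x to the rank, because it
    ranges over a final segment of [S x] starting after the blocks already
    chosen. *)
Lemma block_tree_rank x N :
  (forall M, tree_deriv_iter (schreier_tree x M) (omega_pow x) [::]) ->
  forall j m s, block_tree x N m s ->
  tree_deriv_iter (block_tree x N (m + j))
    (omul (omega_pow x) (iter j osucc ozero)) s.
Proof.
move=> IHx; elim=> [|j IHj] m s Gs; first by rewrite addn0.
rewrite /= tree_deriv_iter_add.
set T := tree_deriv_iter (block_tree _ _ _) _.
pose M := maxn N (last 0%N s).+1.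
rewrite -[s]cats0.
refine (@tree_deriv_iter_image _ _ (cat s) (schreier_tree x M) T (omega_pow x) _ _ [::] (IHx M)).
- move=> u v _ _ uv vu; rewrite prefix_catr // eqxx; split => //.
  by move/eqP; rewrite eqseq_cat // eqxx => /eqP.
move=> b [hb hbM Sb]; rewrite /T addnS -addSn; apply: IHj.
case: Gs => ss def_s [szm ne Sss hs hN].
have [b0|b0] := eqVneq b [::].
  by exists ss; rewrite b0 cats0 //; split=> //; apply: leq_trans szm _.
exists (rcons ss b); first by rewrite flatten_rcons -def_s.
split.
- by rewrite size_rcons.
- by rewrite all_rcons b0.
- by move=> c; rewrite mem_rcons inE => /orP[/eqP->|/Sss].
- case: s {def_s} hs hN @M hbM => // a s /= hs hN hbM.
  rewrite cat_path hs /=.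
  case: b {Sb b0} hb hbM => //= c b -> /andP[+ _].
  by rewrite geq_max => /andP[_ ->].
- rewrite all_cat hN /=; apply: sub_all hbM => n.
  by rewrite geq_max => /andP[].
Qed.

Lemma schreier_tree_mono x N M : (N <= M)%N ->
  schreier_tree x M `<=` schreier_tree x N.
Proof.
move=> NM s [hs hM Sx]; split=> //; apply: sub_all hM => n; exact: leq_trans.
Qed.

(** A lower bound of Cantor-Bendixson type. At a successor the
    sets starting beyond [j] contain all unions of [j] successive members of
    the previous family, of rank omega ^ x * j. *)
Lemma schreier_rank x : olt x omega1 ->
  forall N, tree_deriv_iter (schreier_tree x N) (omega_pow x) [::].
Proof.
elim/(well_founded_ind olt_wf): x => x IH xw N.
have [x0|[y xy]|xlim] := ord_cases x.
- apply: (@tree_deriv_iter_anti _ _ _ (omega_pow ozero)).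
    by apply: omega_pow_mono; case: x0.
  rewrite /=; apply/tree_derivP; split.
    split=> //; rewrite (schreier_ext hS x0) (schreier_zero hS) fset_of_seq_nil.
    by left.
  exists [:: N.+1] => //; split=> //=; first by rewrite leqnSn.
  rewrite (schreier_ext hS x0) (schreier_zero hS).
  by right; exists N.+1 => //; apply/fsetP => n; rewrite !inE orbF.
- have yx : olt y x by case: xy.
  have yw : olt y omega1 := olt_ole_trans yx (oltW xw).
  apply: (@tree_deriv_iter_anti _ _ _ (omega_pow (osucc y))).
    by apply: omega_pow_mono; case: xy.
  move=> j _ /=.
  have G0 : block_tree y (maxn N j.+1) 0 [::] by exists [::].
  have := block_tree_rank (IH y yx yw) j G0.
  apply: tree_deriv_iter_mono => s Gs.
  apply: (@schreier_tree_mono _ _ (maxn N j.+1)); first exact: leq_maxl.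
  have [hs hN Sy] : schreier_tree (osucc y) (maxn N j.+1) s.
    apply: (@block_tree_schreier_tree _ _ j.+1) => //; first by rewrite leq_maxr.
    case: Gs => ss def_s [szm *]; exists ss => //; split=> //.
    exact: leq_trans szm _.
  by split=> //; rewrite (schreier_ext hS xy).
- have [xs [xs_succ xs_lt x_sup xs_sub Sx]] := schreier_limit hS xlim xw.
  apply: (@tree_deriv_iter_anti _ _ _ (omega_pow (osup 0%N xs))).
    by apply: omega_pow_mono; case: x_sup.
  move=> n _ /=.
  have xnx : olt (xs n) x.
    case: x_sup => _ h; apply: olt_ole_trans (xs_lt n) _; exact: h.
  have := IH _ xnx (olt_ole_trans xnx (oltW xw)) (maxn N n.+1).
  apply: tree_deriv_iter_mono => s [hs hN Ss].
  split=> //; first by apply: sub_all hN => i; rewrite geq_max => /andP[].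
  rewrite Sx /=; have [->|s0] := eqVneq s [::].
    by right; rewrite fset_of_seq_nil.
  left; exists n => //; rewrite fset_min_of_seq //.
  case: s s0 hN {Ss hs} => // a s _ /= /andP[+ _].
  by rewrite geq_max => /andP[].
Qed.

(** * The first Schreier family *)

Lemma schreier1_of_seq N s : (0 < N)%N -> sorted ltn s -> all (leq N) s ->
  (size s <= N)%N -> S oone [fset n in s]%fset.
Proof.
move=> N0 hs hN szs.
have o0 : olt ozero omega1 by exists (Defs.csucc Defs.czero).
suff /(block_tree_schreier_tree _ o0) : block_tree ozero N N s.
  by rewrite N0 leqnn => /(_ isT)[].
exists [seq [:: n] | n <- s]; first by rewrite flatten_seq1.
split=> //; first by rewrite size_map.
- by rewrite all_map; apply/allP.
- move=> b /mapP[n ns ->]; rewrite (schreier_zero hS); right; exists n.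
    by apply: leq_trans N0 (allP hN _ ns).
  by apply/fsetP => i; rewrite !inE orbF.
Qed.

Lemma schreier_notin0 x : ole x omega1 -> forall E, S x E -> 0%N \notin E.
Proof.
elim/(well_founded_ind olt_wf): x => x IH xw E.
case: (ole_or_olt omega1 x) => [wx|{}xw].
  by rewrite (schreier_ext hS (conj xw wx)) (schreier_omega1 hS).
have [x0|[y xy]|xlim] := ord_cases x.
- rewrite (schreier_ext hS x0) (schreier_zero hS) => -[->|[n n0 ->]].
    by rewrite inE.
  by rewrite inE eq_sym -lt0n.
- have yx : olt y x by case: xy.
  have yw : olt y omega1 := olt_ole_trans yx (oltW xw).
  rewrite (schreier_ext hS xy) (schreier_succ hS yw) => -[Es [_ _ _ SE ->]].
  apply/bigfcupP => -[D /andP[DEs _] D0].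
  by have := IH y yx (oltW yw) D (SE D DEs); rewrite D0.
- have [xs [_ xs_lt x_sup _ ->]] := schreier_limit hS xlim xw.
  move=> [[n _ SE]|->]; last by rewrite inE.
  have xnx : olt (xs n) x.
    by case: x_sup => _ h; apply: olt_ole_trans (xs_lt n) _; exact: h.
  exact: (IH _ xnx (oltW (olt_ole_trans xnx (oltW xw)))).
Qed.

(** A nonempty member of [S y] is a single block; its minimum is positive, so
    that one block is allowed. *)
Lemma schreier_sub_succ y : olt y omega1 -> S y `<=` S (osucc y).
Proof.
move=> yw E SE; rewrite (schreier_succ hS yw).
have [->|E0] := eqVneq E fset0.
  exists [::]; split=> //; last by rewrite big_nil.
  by right; rewrite /= fset_of_seq_nil.
exists [:: E]; split=> //=; rewrite ?E0 //; last by rewrite big_seq1.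
  left; rewrite /= fset_min_of_seq //=.
  apply: leq_trans (card_fset_of_seq _) _ => /=; rewrite lt0n.
  apply/eqP => h; have := schreier_notin0 (oltW yw) SE.
  by rewrite -h fset_min_mem.
by move=> D; rewrite inE => /eqP->.
Qed.

Lemma schreier1_sub x : olt ozero x -> ole x omega1 -> S oone `<=` S x.
Proof.
elim/(well_founded_ind olt_wf): x => x IH x0 xw E SE.
have o1 : ole oone omega1 by exists (Defs.csucc Defs.czero).
have E0 := schreier_notin0 o1 SE.
case: (ole_or_olt omega1 x) => [wx|{}xw].
  by rewrite (schreier_ext hS (conj xw wx)) (schreier_omega1 hS).
have [xz|[y xy]|xlim] := ord_cases x.
- by have := olt_ole_trans x0 (proj1 xz).
- have yx : olt y x by case: xy.
  have yw : olt y omega1 := olt_ole_trans yx (oltW xw).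
  rewrite (schreier_ext hS xy).
  case: (ole_or_olt y ozero) => [y0|y0]; last first.
    by apply: schreier_sub_succ => //; apply: IH yx y0 (oltW yw) _ SE.
  by rewrite (@schreier_ext _ hS _ oone) //; split.
- have [xs [xs_succ xs_lt x_sup _ ->]] := schreier_limit hS xlim xw.
  have [->|En] := eqVneq E fset0; first by right.
  left; exists 0%N.
    rewrite lt0n; apply/eqP => h.
    by move: E0; rewrite -h fset_min_mem.
  have xnx : olt (xs 0%N) x.
    by case: x_sup => _ h; apply: olt_ole_trans (xs_lt 0%N) _; exact: h.
  apply: IH xnx _ (oltW (olt_ole_trans xnx (oltW xw))) _ SE.
  by case: (xs_succ 0%N) => z [_ zx]; apply: (@ole_trans (osucc z)) => //.
Qed.

End SchreierRank.

(** * Real-valued norms over the scalar field *)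

Section Scalars.
Variables (R : realType) (k : scalar_kind).
Notation K := (scalar_field R k).
Notation sre := (@scalar_re R k).
Notation sabs := (@scalar_abs R k).

Definition scalar_of_real : R -> K :=
  match k return R -> scalar_field R k with
  | RealScalars => fun a => a
  | ComplexScalars => fun a => (a +i* 0)%C
  end.

Lemma scalar_of_realD a b :
  scalar_of_real (a + b) = scalar_of_real a + scalar_of_real b.
Proof.
rewrite /scalar_of_real; case: k => //=.
by apply/eqP; rewrite eq_complex /= addr0 !eqxx.
Qed.

Lemma scalar_of_realM a b :
  scalar_of_real (a * b) = scalar_of_real a * scalar_of_real b.
Proof.
rewrite /scalar_of_real; case: k => //=.
by apply/eqP; rewrite eq_complex /= !mulr0 !mul0r subr0 addr0 !eqxx.
Qed.

Lemma scalar_of_realK a : sre (scalar_of_real a) = a.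
Proof. by rewrite /scalar_re /scalar_of_real; case: k. Qed.

Lemma scalar_reK (a : K) : 0 <= a -> scalar_of_real (sre a) = a.
Proof.
rewrite /scalar_re /scalar_of_real; case: k a => //= -[a b] /= h.
by apply/eqP; move: h; rewrite eq_complex lecE /= => /andP[/eqP-> _]; rewrite !eqxx.
Qed.

Lemma ler_scalar_of_real a b : (scalar_of_real a <= scalar_of_real b) = (a <= b).
Proof.
rewrite /scalar_of_real; case: k => //=.
by rewrite lecE /= eqxx.
Qed.

Lemma scalar_of_real0 : scalar_of_real 0 = 0.
Proof. by rewrite /scalar_of_real; case: k. Qed.

Lemma scalar_of_real1 : scalar_of_real 1 = 1.
Proof. by rewrite /scalar_of_real; case: k. Qed.

Lemma norm_scalar_of_real a : `|scalar_of_real a| = scalar_of_real `|a|.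
Proof.
have h b : 0 <= b -> `|scalar_of_real b| = scalar_of_real b.
  by move=> b0; rewrite ger0_norm // -scalar_of_real0 ler_scalar_of_real.
case: (leP 0 a) => [a0|/ltW a0]; first by rewrite h // ger0_norm.
rewrite [in RHS]ler0_norm // -normrN.
have -> : - scalar_of_real a = scalar_of_real (- a).
  by apply/eqP; rewrite eq_sym -addr_eq0 -scalar_of_realD addNr scalar_of_real0.
by rewrite h // oppr_ge0.
Qed.

Lemma scalar_absE (a : K) : `|a| = scalar_of_real (sabs a).
Proof. by rewrite scalar_reK. Qed.

Lemma scalar_abs_eq (a : K) r : `|a| = scalar_of_real r -> sabs a = r.
Proof. by rewrite /scalar_abs => ->; rewrite scalar_of_realK. Qed.

Lemma scalar_abs_ge0 (a : K) : 0 <= sabs a.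
Proof. by rewrite -ler_scalar_of_real -scalar_absE scalar_of_real0. Qed.

Lemma scalar_abs0 : sabs 0 = 0.
Proof. by apply: scalar_abs_eq; rewrite normr0 scalar_of_real0. Qed.

Lemma scalar_abs1 : sabs 1 = 1.
Proof. by apply: scalar_abs_eq; rewrite normr1 scalar_of_real1. Qed.

Lemma scalar_abs_eq0 (a : K) : sabs a = 0 -> a = 0.
Proof.
move=> h; apply/eqP; rewrite -normr_eq0 scalar_absE h.
by rewrite scalar_of_real0.
Qed.

Lemma scalar_absM (a b : K) : sabs (a * b) = sabs a * sabs b.
Proof.
by apply: scalar_abs_eq; rewrite normrM !scalar_absE -scalar_of_realM.
Qed.

Lemma scalar_absN (a : K) : sabs (- a) = sabs a.
Proof. by rewrite /scalar_abs normrN. Qed.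

Lemma scalar_abs_real a : sabs (scalar_of_real a) = `|a|.
Proof. by apply: scalar_abs_eq; rewrite norm_scalar_of_real. Qed.

Lemma ler_scalar_absD (a b : K) : sabs (a + b) <= sabs a + sabs b.
Proof.
by rewrite -ler_scalar_of_real scalar_of_realD -!scalar_absE ler_normD.
Qed.

Lemma scalar_absB (a b : K) : sabs (a - b) = sabs (b - a).
Proof. by rewrite -scalar_absN opprB. Qed.

(** Used to align the values of several functions at one point, so that the
    absolute values add up. *)
Lemma scalar_align (a : K) :
  exists2 c : K, sabs c = 1 & c * a = scalar_of_real (sabs a).
Proof.
have [->|a0] := eqVneq a 0.
  by exists 1; rewrite ?scalar_abs1 // mulr0 scalar_abs0 scalar_of_real0.
exists (`|a| / a); last by rewrite divfK // scalar_absE.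
apply: scalar_abs_eq.
by rewrite normrM normrV ?unitfE // normr_id divff ?normr_eq0 // scalar_of_real1.
Qed.

Section Rnorm.
Variable X : normedModType K.
Implicit Types x y : X.

Lemma rnormE x : `|x| = scalar_of_real (rnorm x).
Proof. by rewrite scalar_reK. Qed.

Lemma rnorm_eq x r : `|x| = scalar_of_real r -> rnorm x = r.
Proof. by rewrite /rnorm => ->; rewrite scalar_of_realK. Qed.

Lemma rnorm_ge0 x : 0 <= rnorm x.
Proof. by rewrite -ler_scalar_of_real -rnormE scalar_of_real0. Qed.

Lemma rnorm0 : rnorm (0 : X) = 0.
Proof. by apply: rnorm_eq; rewrite normr0 scalar_of_real0. Qed.

Lemma rnormZ a x : rnorm (a *: x) = sabs a * rnorm x.
Proof.
by apply: rnorm_eq; rewrite normrZ scalar_absE rnormE -scalar_of_realM.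
Qed.

End Rnorm.

Section LpNorm.
Variable p : \bar R.
Hypothesis hp : (1%:E <= p)%E.
Implicit Types (E : seq nat) (c : nat -> K).

Lemma lp_norm_abs E c d : (forall i, i \in E -> sabs (c i) = sabs (d i)) ->
  lp_norm p E c = lp_norm p E d.
Proof.
move=> h; rewrite /lp_norm; case: p => [r||].
- by congr (_ `^ _); apply: eq_big_seq => i iE; rewrite h.
- by apply: eq_big_seq => i iE; rewrite h.
- by apply: eq_big_seq => i iE; rewrite h.
Qed.

Lemma lp_norm_perm E E' c : perm_eq E E' -> lp_norm p E c = lp_norm p E' c.
Proof.
move=> h; rewrite /lp_norm; case: p => [r||].
- by congr (_ `^ _); apply: perm_big.
- exact: perm_big.
- exact: perm_big.
Qed.

Lemma lp_norm_ge0 E c : 0 <= lp_norm p E c.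
Proof.
rewrite /lp_norm; case: p => [r||]; first exact: powR_ge0.
- elim/big_ind: _ => // [x y x0 y0|i _]; first by rewrite le_max x0.
  exact: scalar_abs_ge0.
- elim/big_ind: _ => // [x y x0 y0|i _]; first by rewrite le_max x0.
  exact: scalar_abs_ge0.
Qed.

Lemma lp_norm_map (h : nat -> nat) E c :
  lp_norm p [seq h i | i <- E] c = lp_norm p E (fun i => c (h i)).
Proof. by rewrite /lp_norm; case: p => [r||]; rewrite big_map. Qed.

Lemma lp_norm_index E c : uniq E ->
  lp_norm p E (fun n => c (index n E)) = lp_norm p (iota 0 (size E)) c.
Proof.
move=> uE; rewrite -[in LHS](mkseq_nth 0%N E) [LHS]lp_norm_map.
apply: lp_norm_abs => i; rewrite mem_iota /= => iE.
by rewrite mkseq_nth index_uniq.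
Qed.

Lemma lp_norm_single E c i : uniq E -> i \in E ->
  (forall j, j \in E -> j != i -> c j = 0) -> lp_norm p E c = sabs (c i).
Proof.
move=> uE iE h; rewrite (lp_norm_perm _ (perm_to_rem iE)) /lp_norm.
have nE j : j \in rem i E -> sabs (c j) = 0.
  rewrite mem_rem_uniq // inE => /andP[ji jE].
  by rewrite h // scalar_abs0.
case: p hp => [r||] //.
- rewrite lee_fin => r1.
  have r0 : r != 0 by apply: lt0r_neq0; apply: lt_le_trans r1.
  rewrite big_cons big_seq big1 => [|j /nE->]; last by rewrite powR0.
  by rewrite addr0 -powRrM mulfV // powRr1 // scalar_abs_ge0.
- move=> _; rewrite big_cons big_seq big1_idem.
  + by rewrite max_l // scalar_abs_ge0.
  + exact: maxxx.
  + by move=> j /nE.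
Qed.

Lemma lp_norm_ones E c : (forall j, j \in E -> sabs (c j) = 1) ->
  lp_norm p E c <= match p with r%:E => (size E)%:R `^ r^-1 | _ => 1 end.
Proof.
move=> h; rewrite /lp_norm; case: p => [r||].
- rewrite big_seq (eq_bigr (fun=> 1)) => [|j /h->]; last by rewrite powR1.
  by rewrite -big_seq big_const_seq count_predT iter_addr addr0 -mulr_natl mulr1.
- by rewrite big_seq; apply: bigmax_le => // j /h->.
- by rewrite big_seq; apply: bigmax_le => // j /h->.
Qed.

End LpNorm.
End Scalars.

(** * Spreading models produce trees of large order *)

Section SpreadingToTree.
Variables (R : realType) (k : scalar_kind) (p : \bar R).
Hypothesis hp : (1%:E <= p)%E.
Notation K := (scalar_field R k).

Lemma not_NP_class (X Y : completeNormedModType K) (A : operator X Y) L x :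
  1 <= L -> tree_deriv_iter (lp_tree p A L) (omega_pow x) [::] ->
  ~ NP_class p x A.
Proof.
move=> L1 hL; rewrite /NP_class /NP_index /eosup.
case: pselect => [hN|_] /=; last by case.
pose L' : {L : R | 1 <= L} := exist _ L L1.
move=> /(_ L') hL'; apply: (tree_order_gt hL).
have := hN L'; rewrite /= in hL' *.
by case: (tree_order _) hL'.
Qed.

Lemma perm_fset_of_seq s : sorted ltn s -> perm_eq [fset n in s]%fset s.
Proof. by move=> hs; rewrite -(perm_sort leq) sort_fset_of_seq. Qed.

Lemma comb_norm_perm (X : normedModType K) (u : nat -> X) E E' c :
  perm_eq E E' -> comb_norm u E c = comb_norm u E' c.
Proof. by move=> h; rewrite /comb_norm (perm_big _ h). Qed.

Lemma comb_norm_index (X : normedModType K) (u : nat -> X) E c : uniq E ->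
  comb_norm u E (fun n => c (index n E)) =
  comb_norm (fun i => u (nth 0%N E i)) (iota 0 (size E)) c.
Proof.
move=> uE; rewrite /comb_norm -[in LHS](mkseq_nth 0%N E) big_map.
congr rnorm; apply: eq_big_seq => i; rewrite mem_iota /= => iE.
by rewrite mkseq_nth index_uniq.
Qed.

Lemma comb_norm_single (X : normedModType K) (u : nat -> X) E i :
  uniq E -> i \in E -> comb_norm u E (fun j => (j == i)%:R) = rnorm (u i).
Proof.
move=> uE iE; rewrite /comb_norm (perm_big _ (perm_to_rem iE)) big_cons.
rewrite eqxx scale1r big_seq big1; first by rewrite /= addr0.
by move=> j; rewrite mem_rem_uniq // inE => /andP[/negPf-> _]; rewrite scale0r.
Qed.

Lemma comb_normZ (X : normedModType K) (u : nat -> X) (r : R) E c : 0 <= r ->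
  comb_norm (fun i => scalar_of_real k r *: u i) E c = r * comb_norm u E c.
Proof.
move=> r0; rewrite /comb_norm -{2}[r]ger0_norm // -(scalar_abs_real k) -rnormZ.
congr rnorm; rewrite scaler_sumr; apply: eq_bigr => i _.
by rewrite !scalerA mulrC.
Qed.

Lemma eq_comb_norm (X : normedModType K) (u v : nat -> X) E c :
  (forall i, i \in E -> u i = v i) -> comb_norm u E c = comb_norm v E c.
Proof.
by move=> h; rewrite /comb_norm; congr rnorm; apply: eq_big_seq => i /h->.
Qed.

Lemma spreading_model_seq (F : set {fset nat}) (X : completeNormedModType K)
    (u : nat -> X) : spreading_model p F u ->
  exists a b : R, [/\ 0 < a, 0 < b & forall s, sorted ltn s ->
    F [fset n in s]%fset -> forall c,
    lp_norm p s c <= a * comb_norm u s c /\ comb_norm u s c <= b * lp_norm p s c].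
Proof.
move=> [a [b [a0 b0 hu]]]; exists a, b; split=> // s hs Fs c.
have [/(_ c) + /(_ c)] := hu _ Fs.
rewrite (comb_norm_perm _ _ (perm_fset_of_seq hs)).
by rewrite (lp_norm_perm _ _ (perm_fset_of_seq hs)).
Qed.

(** The upper estimate for [u] bounds the scaling factor, and then the lower
    estimate for the images gives the constant [L]; neither depends on the
    member of [F]. *)
Lemma spreading_model_tree (F : set {fset nat}) (X Y : completeNormedModType K)
    (A : operator X Y) (u : nat -> X) :
  spreading_model p F u -> spreading_model p F (fun n => A (u n)) ->
  exists2 L : R, 1 <= L & exists x : nat -> X,
    forall s, sorted ltn s -> F [fset n in s]%fset ->
      lp_tree p A L [seq x n | n <- s].
Proof.
move=> /spreading_model_seq[a [b [a0 b0 hu]]].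
move=> /spreading_model_seq[a' [b' [a'0 b'0 hAu]]].
pose B := Num.max b 1.
have B1 : 1 <= B by rewrite le_max lexx orbT.
have B0 : 0 < B by apply: lt_le_trans B1.
have Bi0 : 0 <= B^-1 by rewrite invr_ge0 ltW.
exists (Num.max 1 (a' * B)); first by rewrite le_max lexx.
exists (fun n => scalar_of_real k B^-1 *: u n) => s hs Fs.
have us : uniq s by apply: sorted_uniq hs; [exact: ltn_trans|exact: ltnn].
have ub c : comb_norm u s c <= B * lp_norm p s c.
  have [_ /le_trans] := hu s hs Fs c; apply.
  by rewrite ler_wpM2r ?lp_norm_ge0 // le_max lexx.
have lb c : lp_norm p s c <= a' * comb_norm (fun n => A (u n)) s c.
  by have [] := hAu s hs Fs c.
have nthE i : i \in iota 0 (size s) ->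
    nth 0 [seq scalar_of_real k B^-1 *: u n | n <- s] i =
    scalar_of_real k B^-1 *: u (nth 0%N s i).
  by rewrite mem_iota /= => iE; rewrite (nth_map 0%N).
split; rewrite ?size_map.
- move=> x /mapP[n ns ->]; rewrite rnormZ scalar_abs_real ger0_norm //.
  rewrite mulrC ler_pdivrMr // mul1r.
  rewrite -(comb_norm_single _ us ns); apply: le_trans (ub _) _.
  rewrite (@lp_norm_single _ _ _ hp _ _ n) //.
    by rewrite eqxx scalar_abs1 mulr1.
  by move=> j _ /negPf->.
- move=> c; rewrite mul1r (eq_comb_norm _ nthE) comb_normZ //.
  rewrite -(comb_norm_index u) // -lp_norm_index // mulrC ler_pdivrMr //.
  by rewrite mulrC.
- move=> c; rewrite -lp_norm_index //; apply: le_trans (lb _) _.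
  rewrite comb_norm_index //.
  rewrite [X in _ <= _ * X](@eq_comb_norm _ _ (fun i => scalar_of_real k B^-1 *: A (u (nth 0%N s i)))).
    rewrite comb_normZ // mulrA.
    rewrite ler_wpM2r ?rnorm_ge0 //.
    by rewrite ler_pdivlMr // le_max lexx orbT.
  by move=> i /nthE->; rewrite linearZ.
Qed.

End SpreadingToTree.

Section NPSubSM.
Variables (R : realType) (k : scalar_kind) (p : \bar R).
Hypothesis hp : (1%:E <= p)%E.
Variables (S : ord -> set {fset nat}) (hS : schreier_families S).

(** The rank of the Schreier family survives in the tree of [A]. At omega_1
    every finite increasing sequence of positive integers is a node, and the
    tree does not decrease under derivation. *)
Lemma NP_class_sub_SM_class x : ole x omega1 ->
  @subclass R k (NP_class p x) (SM_class p (S x)).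
Proof.
move=> xw X Y A NPA u uS AuS.
have [L L1 [v hv]] := spreading_model_tree hp uS AuS.
apply: (not_NP_class L1 _ NPA).
have map_ext (s t : seq nat) : prefix s t -> t <> s ->
    prefix [seq v n | n <- s] [seq v n | n <- t] /\
    [seq v n | n <- t] <> [seq v n | n <- s].
  move=> /prefixP[t' ->] ts; rewrite map_cat prefix_prefix; split => //.
  move=> /(congr1 size)/eqP; rewrite size_cat !size_map -[X in _ == X]addn0.
  by rewrite eqn_add2l => /nilP t'0; rewrite t'0 cats0 in ts.
case: (ole_or_olt omega1 x) => [wx|{}xw].
  pose P : set (seq nat) := [set s | sorted ltn s /\ 0%N \notin s].
  refine (@tree_deriv_iter_image _ _ (map v) P _ _ _ _ [::] _).
  - by move=> s t _ _; exact: map_ext.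
  - move=> s [hs s0]; apply: hv => //.
    by rewrite (schreier_ext hS (conj xw wx)) (schreier_omega1 hS) /= !inE.
  - apply: tree_deriv_iter_perfect; last by [].
    move=> s [hs s0]; exists (rcons s (last 0%N s).+1).
      split; last by rewrite mem_rcons inE negb_or s0.
      by case: s hs {s0} => //= a s hs; rewrite rcons_path hs /=.
    rewrite prefix_rcons; split => // /(congr1 size)/eqP.
    by rewrite size_rcons (gtn_eqF (ltnSn _)).
refine (@tree_deriv_iter_image _ _ (map v) (schreier_tree S x 0) _ _ _ _ [::] _).
- by move=> s t _ _; exact: map_ext.
- by move=> s [hs _ Ss]; apply: hv.
- exact: schreier_rank.
Qed.

Lemma spreading_model_sub (F G : set {fset nat}) (X : completeNormedModType (scalar_field R k))
    (u : nat -> X) : F `<=` G -> spreading_model p G u -> spreading_model p F u.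
Proof. by move=> FG [a [b [a0 b0 h]]]; exists a, b; split=> // E /FG/h. Qed.

Lemma SM_class1_sub x : olt ozero x -> ole x omega1 ->
  @subclass R k (SM_class p (S oone)) (SM_class p (S x)).
Proof.
move=> x0 xw X Y A hA u hu hAu.
have S1x := schreier1_sub hS x0 xw.
exact: (hA u (spreading_model_sub S1x hu) (spreading_model_sub S1x hAu)).
Qed.

End NPSubSM.

(** * Ultrafilter limits of bounded scalars *)

Lemma scalar_abs_complex (R : realType) (z : scalar_field R ComplexScalars) :
  scalar_abs z = Num.sqrt (complex.Re z ^+ 2 + complex.Im z ^+ 2).
Proof. by case: z. Qed.

Section UltraLimit.
Variables (T : Type) (U : set_system T).
Hypothesis UU : UltraFilter U.

(** The limit is the supremum of the numbers that are eventually below [h]. *)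
Lemma ultra_real_lim (R : realType) (h : T -> R) M :
  U [set i | `|h i| <= M] ->
  exists z, forall e, 0 < e -> U [set i | `|h i - z| <= e].
Proof.
move=> hM; pose A := [set r | U [set i | r <= h i]].
have AM : ubound A M.
  move=> r Ar; have [i [/= ri iM]] := filter_ex (filterI Ar hM).
  by apply: le_trans ri _; apply: le_trans iM; apply: ler_norm.
have A0 : A (- M).
  apply: filterS hM => i /= iM; rewrite lerNl; apply: le_trans iM.
  by rewrite -normrN ler_norm.
have supA : has_sup A by split; [exists (- M)|exists M].
exists (sup A) => e e0.
have h1 : U [set i | sup A - e <= h i].
  have [r Ar er] := sup_adherent e0 supA.
  by apply: filterS Ar => i /= ri; apply: le_trans (ltW er) ri.
have h2 : U [set i | h i <= sup A + e].
  have [Ae|Ae] := in_ultra_setVsetC [set i | sup A + e <= h i] UU.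
    have := ub_le_sup (ex_intro _ M AM) Ae.
    by rewrite gerDl leNgt e0.
  by apply: filterS Ae => i /= /negP; rewrite -ltNge => /ltW.
apply: filterS2 h1 h2 => i /= h1 h2.
by rewrite ler_norml lerBrDr addrC h1 lerBlDr addrC.
Qed.

Lemma ultra_scalar_lim (R : realType) (k : scalar_kind)
    (h : T -> scalar_field R k) M :
  U [set i | scalar_abs (h i) <= M] ->
  exists z, forall e, 0 < e -> U [set i | scalar_abs (h i - z) <= e].
Proof.
case: k h => h hM; first exact: (ultra_real_lim hM).
have le_sq (a b : R) : `|a| <= Num.sqrt (a ^+ 2 + b ^+ 2).
  by rewrite -sqrtr_sqr ler_wsqrtr // lerDl sqr_ge0.
have [x hx] : exists x, forall e, 0 < e -> U [set i | `|complex.Re (h i) - x| <= e].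
  apply: (@ultra_real_lim _ _ M); apply: filterS hM => i; apply: le_trans.
  by rewrite scalar_abs_complex; apply: le_sq.
have [y hy] : exists y, forall e, 0 < e -> U [set i | `|complex.Im (h i) - y| <= e].
  apply: (@ultra_real_lim _ _ M); apply: filterS hM => i; apply: le_trans.
  by rewrite scalar_abs_complex addrC; apply: le_sq.
exists (x +i* y)%C => e e0.
have e2 : 0 < e / 2 by rewrite divr_gt0.
apply: filterS2 (hx _ e2) (hy _ e2) => i.
rewrite /mkset scalar_abs_complex; case: (h i) => a b /=.
rewrite !ler_norml => /andP[a1 a2] /andP[b1 b2].
rewrite -[leRHS]ger0_norm ?(ltW e0) // -sqrtr_sqr ler_wsqrtr //.
by nra.
Qed.

End UltraLimit.

(** * Banach spaces of functions defined by families of weights *)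

Section Pairing.
Variables (R : realType) (k : scalar_kind) (I : Type).
Notation K := (scalar_field R k).
Implicit Types (w : seq (I * R)) (f g : I -> K).

Definition pairing w f : R := \sum_(tw <- w) tw.2 * scalar_abs (f tw.1).

Definition nonneg_weight w := all (fun tw => 0 <= tw.2) w.

Lemma pairing_cat w w' f : pairing (w ++ w') f = pairing w f + pairing w' f.
Proof. by rewrite /pairing big_cat. Qed.

Lemma ler_pairingD w f g h : nonneg_weight w ->
  (forall t, scalar_abs (h t) <= scalar_abs (f t) + scalar_abs (g t)) ->
  pairing w h <= pairing w f + pairing w g.
Proof.
move=> + H; elim: w => [|tw w IH] /=; first by rewrite /pairing !big_nil addr0.
move=> /andP[tw0 /IH w0]; rewrite /pairing !big_cons addrACA.
by rewrite lerD // -mulrDr ler_wpM2l.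
Qed.

Lemma pairingZ w a f : pairing w (fun t => a * f t) = scalar_abs a * pairing w f.
Proof.
rewrite /pairing mulr_sumr; apply: eq_bigr => tw _.
by rewrite scalar_absM mulrCA.
Qed.

End Pairing.

(** A family of finitely supported nonnegative weights. It plays the part of
    the unit ball of a norming set of functionals; the singletons make the
    resulting seminorm a norm that dominates all coordinates. *)
Record weight_system (R : realType) (I : Type) := WeightSystem {
  weights : set (seq (I * R));
  weights_ge0 : forall w, weights w -> nonneg_weight w;
  weights_nil : weights [::];
  weights_point : forall t, weights [:: (t, 1)]
}.

Section WeightSpace.
Variables (R : realType) (k : scalar_kind) (I : Type) (W : weight_system R I).
Notation K := (scalar_field R k).

Definition wbounded : {pred (I -> K)} :=
  fun f => `[< exists M, forall w, weights W w -> pairing w f <= M >].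

Lemma wbounded_submod : GRing.submod_closed wbounded.
Proof.
split.
  apply/asboolP; exists 0 => w Ww; rewrite /pairing big1 // => tw _.
  by rewrite scalar_abs0 mulr0.
move=> a f g /asboolP[M hM] /asboolP[N hN]; apply/asboolP.
exists (scalar_abs a * M + N) => w Ww.
apply: le_trans (_ : scalar_abs a * pairing w f + pairing w g <= _).
  rewrite -pairingZ; apply: ler_pairingD; first exact: weights_ge0 Ww.
  by move=> t; apply: ler_scalar_absD.
by rewrite lerD ?hN // ler_wpM2l ?hM // scalar_abs_ge0.
Qed.

HB.instance Definition _ :=
  GRing.isSubmodClosed.Build K (I -> K) wbounded wbounded_submod.

Record wspace : Type := WSpace { wfun :> I -> K; _ : wfun \in wbounded }.

HB.instance Definition _ := [isSub for wfun].
HB.instance Definition _ := [Choice of wspace by <:].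
HB.instance Definition _ := [SubChoice_isSubLmodule of wspace by <:].

Implicit Types f g : wspace.

Definition wnorm f : R := sup [set pairing w f | w in weights W].

Lemma wspace_has_sup f : has_sup [set pairing w f | w in weights W].
Proof.
split; first by exists (pairing [::] f); exists [::] => //; apply: weights_nil.
case: f => f /= /asboolP[M hM]; exists M => _ [w Ww <-]; exact: hM.
Qed.

Lemma wnorm_ub f w : weights W w -> pairing w f <= wnorm f.
Proof. by move=> Ww; apply: ub_le_sup; [case: (wspace_has_sup f)|exists w]. Qed.

Lemma wnorm_le f M : (forall w, weights W w -> pairing w f <= M) -> wnorm f <= M.
Proof.
move=> hM; apply: ge_sup; first by case: (wspace_has_sup f).
by move=> _ [w Ww <-]; apply: hM.
Qed.

Lemma wnorm_point f t : scalar_abs (f t) <= wnorm f.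
Proof.
apply: le_trans (wnorm_ub f (weights_point W t)).
by rewrite /pairing big_seq1 /= mul1r.
Qed.

Lemma ler_wnormD f g : wnorm (f + g) <= wnorm f + wnorm g.
Proof.
apply: wnorm_le => w Ww.
apply: le_trans (lerD (wnorm_ub f Ww) (wnorm_ub g Ww)).
apply: ler_pairingD; first exact: weights_ge0 Ww.
by move=> t; apply: ler_scalar_absD.
Qed.

Lemma wnormZ a f : wnorm (a *: f) = scalar_abs a * wnorm f.
Proof.
have le_aux b g : wnorm (b *: g) <= scalar_abs b * wnorm g.
  apply: wnorm_le => w Ww; rewrite [leLHS](pairingZ w b g).
  by rewrite ler_wpM2l ?scalar_abs_ge0 // wnorm_ub.
apply/eqP; rewrite eq_le le_aux /=.
have [->|a0] := eqVneq a 0.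
  rewrite scalar_abs0 mul0r.
  by apply: le_trans (wnorm_ub _ (weights_nil W)); rewrite /pairing big_nil.
rewrite -{1}[f]scale1r -(mulVf a0) -scalerA.
apply: le_trans (ler_wpM2l (scalar_abs_ge0 a) (le_aux _ _)) _.
by rewrite mulrA -scalar_absM mulfV // scalar_abs1 mul1r.
Qed.

Lemma wnorm_eq0 f : wnorm f = 0 -> f = 0.
Proof.
move=> f0; apply/val_inj/funext => t /=; apply: scalar_abs_eq0.
by apply/eqP; rewrite eq_le scalar_abs_ge0 andbT -f0 wnorm_point.
Qed.

Definition wnormK f : K := scalar_of_real k (wnorm f).

Lemma ler_wnormKD f g : wnormK (f + g) <= wnormK f + wnormK g.
Proof. by rewrite -scalar_of_realD ler_scalar_of_real ler_wnormD. Qed.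

Lemma wnormKZ a f : wnormK (a *: f) = `|a| * wnormK f.
Proof. by rewrite scalar_absE -scalar_of_realM /wnormK wnormZ. Qed.

Lemma wnormK_eq0 f : wnormK f = 0 -> f = 0.
Proof.
move=> /(congr1 (@scalar_re R k)); rewrite /wnormK scalar_of_realK => f0.
by apply: wnorm_eq0; rewrite f0 -(scalar_of_real0 R k) scalar_of_realK.
Qed.

HB.instance Definition _ :=
  Lmodule_isNormed.Build K wspace ler_wnormKD wnormKZ wnormK_eq0.

Lemma rnorm_wspace f : rnorm f = wnorm f.
Proof. by exact: scalar_of_realK. Qed.

(** The pointwise limit along an ultrafilter finer than a Cauchy filter is a
    norm limit, since the norm is a supremum of functions of finitely many
    coordinates. *)
Lemma wspace_complete (F : set_system wspace) :
  ProperFilter F -> cauchy F -> cvg F.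
Proof.
move=> FF /cauchyP Fc.
have Fball e : 0 < e -> exists x : wspace, F [set y | wnorm (x - y) <= e].
  move=> e0; have e0' : 0 < scalar_of_real k e.
    by rewrite lt_neqAle -{2}(scalar_of_real0 R k) ler_scalar_of_real (ltW e0) andbT
       -(scalar_of_real0 R k) (inj_eq (can_inj (@scalar_of_realK R k))) lt_eqF.
  have [x Fx] := Fc _ e0'.
  exists x; apply: filterS Fx => y; rewrite -ball_normE /= => /ltW.
  by rewrite -[leLHS]/(wnormK (x - y)) ler_scalar_of_real.
have [U [UU FU]] := ultraFilterLemma FF.
have [x1 Fx1] := Fball 1 ltr01.
have lim t : exists z, forall e, 0 < e ->
    U [set y : wspace | scalar_abs (y t - z) <= e].
  apply: (@ultra_scalar_lim _ _ UU _ _ _ (1 + wnorm x1)).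
  apply: filterS (FU _ Fx1) => y /= yx1.
  rewrite -[y t](addrNK (x1 t)); apply: le_trans (ler_scalar_absD _ _) _.
  apply: lerD (wnorm_point x1 t); rewrite scalar_absB.
  by apply: le_trans yx1; apply: (wnorm_point (x1 - y)).
pose g t := projT1 (cid (lim t)).
have gP t e : 0 < e -> U [set y : wspace | scalar_abs (y t - g t) <= e].
  by rewrite /g; case: cid => z /= + e0; apply.
(* The estimate is closed under pointwise limits: only the finitely many
   coordinates met by [w] matter. *)
have g_near (x : wspace) e w : weights W w -> F [set y | wnorm (x - y) <= e] ->
    pairing w (fun t => g t - x t) <= e.
  move=> Ww Fx; apply/ler_addgt0Pl => d d0.
  pose s := \sum_(tw <- w) tw.2.
  have s0 : 0 <= s.
    rewrite /s; have := weights_ge0 Ww; elim: (w) => [|tw w' IH] /=.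
      by rewrite big_nil.
    by move=> /andP[tw0 /IH]; rewrite big_cons; apply: addr_ge0.
  have d'0 : 0 < d / (s + 1) by rewrite divr_gt0 // ltr_wpDl.
  have Uy : U [set y : wspace |
      pairing w (fun t => g t - y t) <= d / (s + 1) * s].
    move: d'0; move: (d / (s + 1)) => c c0.
    rewrite /s; have := weights_ge0 Ww; elim: (w) => [|tw w' IH] /=.
      by move=> _; apply: filterE => y; rewrite /mkset /pairing !big_nil mulr0 lexx.
    move=> /andP[tw0 /IH{}IH]; apply: filterS2 IH (gP tw.1 c c0) => y /= h1 h2.
    rewrite /pairing !big_cons mulrDr lerD // mulrC ler_wpM2r //.
    by rewrite scalar_absB.
  have [y [/= yg xy]] := filter_ex (filterI Uy (FU _ Fx)).
  apply: le_trans (_ : pairing w (fun t => g t - y t) + wnorm (x - y) <= _).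
    apply: le_trans (lerD (lexx _) (wnorm_ub (x - y) Ww)).
    apply: ler_pairingD; first exact: weights_ge0 Ww.
    move=> t; have -> : g t - x t = (g t - y t) + - (x t - y t).
      by rewrite opprB addrA addrNK.
    by apply: le_trans (ler_scalar_absD _ _) _; rewrite scalar_absN.
  apply: lerD xy; apply: le_trans yg _.
  by rewrite mulrAC ler_pdivrMr ?ltr_wpDl // ler_wpM2l ?(ltW d0) // lerDl.
have gW : g \in wbounded.
  apply/asboolP; exists (1 + wnorm x1) => w Ww.
  apply: le_trans (lerD (g_near _ _ _ Ww Fx1) (wnorm_ub x1 Ww)).
  apply: ler_pairingD; first exact: weights_ge0 Ww.
  by move=> t; rewrite -{1}[g t](addrNK (x1 t)) ler_scalar_absD.
pose g' := WSpace gW.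
apply/cvg_ex; exists g'; apply/cvgrPdist_le => e e0.
have e'E : scalar_of_real k (scalar_re e) = e by rewrite scalar_reK // ltW.
have e'0 : 0 < scalar_re e.
  rewrite lt_neqAle -(ler_scalar_of_real k) e'E scalar_of_real0 (ltW e0) andbT.
  apply/eqP => h; have := congr1 (scalar_of_real k) h.
  by rewrite e'E scalar_of_real0 => h'; rewrite -h' ltxx in e0.
have [x Fx] := Fball (scalar_re e / 2) (divr_gt0 e'0 (ltr0Sn _ _)).
have gx : wnorm (g' - x) <= scalar_re e / 2.
  by apply: wnorm_le => w Ww; apply: (g_near x _ w Ww Fx).
near=> y.
rewrite -[leLHS]/(wnormK (g' - y)) -e'E ler_scalar_of_real.
rewrite -(addrNK x g') -addrA (splitr (scalar_re e)).
apply: le_trans (ler_wnormD _ _) (lerD gx _).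
by near: y.
Unshelve. all: by end_near. Qed.

HB.instance Definition _ := Uniform_isComplete.Build wspace wspace_complete.

Definition weight_space : completeNormedModType K := wspace.

End WeightSpace.

(** * Norming vectors for finite dimensional l_p norms *)

Lemma ler_sum_support (R : realType) (I : eqType) (E E' : seq I) (F G : I -> R) :
  uniq E -> uniq E' -> (forall i, i \in E' -> 0 <= G i) ->
  (forall i, i \in E -> F i != 0 -> i \in E' /\ F i <= G i) ->
  \sum_(i <- E) F i <= \sum_(i <- E') G i.
Proof.
move=> uE uE' G0 FG.
rewrite (bigID (fun i => F i == 0)) /= big1 ?add0r; last by move=> i /eqP.
rewrite -big_filter [leRHS](bigID (fun i => i \in [seq i <- E | F i != 0])) /=.
rewrite -[leLHS]addr0; apply: lerD; last first.
  by rewrite big_seq_cond; apply: sumr_ge0 => i /andP[iE' _]; apply: G0.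
rewrite -[leRHS]big_filter.
rewrite (@perm_big _ _ _ _ [seq i <- E' | i \in [seq i <- E | F i != 0]]
   [seq i <- E | F i != 0] _ G).
  rewrite big_seq [leRHS]big_seq; apply: ler_sum => i.
  by rewrite mem_filter => /andP[Fi iE]; case: (FG i iE Fi).
apply: uniq_perm; [exact: filter_uniq|exact: filter_uniq|].
move=> i; rewrite mem_filter; apply: andb_idr; rewrite mem_filter.
by move=> /andP[Fi iE]; case: (FG i iE Fi).
Qed.

(** Equality case of Hölder's inequality. The dual vector is
    (x_i / |x|) ^ (r - 1), and the upper estimate is Young's inequality summed
    over the coordinates of normalized vectors. *)
Lemma powR_dual_vector (R : realType) (r : R) (E : seq nat) (x : nat -> R) :
  1 <= r -> (forall i, 0 <= x i) -> exists v : nat -> R,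
  [/\ forall i, 0 <= v i,
      forall y : nat -> R, (forall i, 0 <= y i) ->
        \sum_(i <- E) v i * y i <= (\sum_(i <- E) y i `^ r) `^ r^-1
    & (\sum_(i <- E) x i `^ r) `^ r^-1 = \sum_(i <- E) v i * x i].
Proof.
move=> r1 x0.
have r0 : 0 < r by apply: lt_le_trans r1.
have rn0 : r != 0 by apply: lt0r_neq0.
have [N NE] : exists N, N = (fun y : nat -> R => (\sum_(i <- E) y i `^ r) `^ r^-1).
  by eexists.
have N0 y : 0 <= N y by rewrite NE; apply: powR_ge0.
have Ni0 y : 0 <= (N y)^-1 by rewrite invr_ge0.
have S0 y : 0 <= \sum_(i <- E) y i `^ r.
  by apply: sumr_ge0 => i _; apply: powR_ge0.
have NX y : N y `^ r = \sum_(i <- E) y i `^ r.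
  by rewrite NE -powRrM mulVf // (powRr1 (S0 y)).
have N_eq0 y : (forall i, 0 <= y i) -> N y = 0 -> forall i, i \in E -> y i = 0.
  move=> y0 Ny i iE; have : \sum_(i <- E) y i `^ r = 0 by rewrite -NX Ny powR0.
  move/eqP; rewrite psumr_eq0 => [/allP /(_ i iE)/implyP/(_ isT)|j _]; last first.
    exact: powR_ge0.
  by rewrite powR_eq0 => /andP[/eqP].
have [L0|L0] := eqVneq (N x) 0.
  exists (fun=> 0); split=> //.
  - move=> y y0; rewrite big1; first exact: powR_ge0.
    by move=> i _; rewrite mul0r.
  - have -> : (\sum_(i <- E) x i `^ r) `^ r^-1 = N x by rewrite NE.
    by rewrite L0 big1 // => i _; rewrite mul0r.
have Lp : 0 < N x by rewrite lt_neqAle eq_sym L0 N0.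
have unit_sum y : (forall i, 0 <= y i) -> N y != 0 ->
    \sum_(i <- E) (y i / N y) `^ r = 1.
  move=> y0 e0.
  rewrite (eq_bigr (fun i => y i `^ r * (N y)^-1 `^ r)); last first.
    by move=> i _; rewrite (powRM _ (y0 i) (Ni0 y)).
  by rewrite -mulr_suml -NX -(powRM _ (N0 y) (Ni0 y)) (mulfV e0) powR1.
exists (fun i => (x i / N x) `^ (r - 1)); split.
- by move=> i; apply: powR_ge0.
- move=> y y0; have -> : (\sum_(i <- E) y i `^ r) `^ r^-1 = N y by rewrite NE.
  have [Ny|Ny] := eqVneq (N y) 0.
    by rewrite Ny big_seq big1 // => i iE; rewrite (N_eq0 y y0 Ny i iE) mulr0.
  have Nyp : 0 < N y by rewrite lt_neqAle eq_sym Ny N0.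
  rewrite -[leRHS]mul1r -(ler_pdivrMr _ _ Nyp) mulr_suml.
  have [r1'|r1'] := eqVneq r 1.
    rewrite -[leRHS](unit_sum y y0 Ny); apply: ler_sum => i _ /=.
    by rewrite r1' subrr powRr0 mul1r (powRr1 (divr_ge0 (y0 i) (N0 y))).
  have rgt1 : 0 < r - 1 by rewrite subr_gt0 lt_neqAle eq_sym r1'.
  have rm1 : r - 1 != 0 by apply: lt0r_neq0.
  pose q := r / (r - 1).
  have q0 : 0 < q by rewrite divr_gt0.
  have qr : q^-1 + r^-1 = 1 by rewrite /q; field; rewrite rn0.
  apply: le_trans (_ : \sum_(i <- E)
     ((x i / N x) `^ r / q + (y i / N y) `^ r / r) <= _).
    apply: ler_sum => i _ /=; rewrite -mulrA.
    have -> : (x i / N x) `^ r = ((x i / N x) `^ (r - 1)) `^ q.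
      by rewrite -powRrM /q mulrCA mulfV // mulr1.
    apply: conjugate_powR => //; first exact: powR_ge0.
    by rewrite divr_ge0.
  by rewrite big_split /= -!mulr_suml !unit_sum // !mul1r qr.
- have -> : (\sum_(i <- E) x i `^ r) `^ r^-1 = N x by rewrite NE.
  rewrite -[LHS]mulr1 -[X in _ * X = _](unit_sum x x0 L0) mulr_sumr.
  apply: eq_bigr => i _.
  have xL : x i = x i / N x * N x by rewrite divfK.
  have h0 : 0 <= x i / N x by rewrite divr_ge0.
  rewrite [X in _ = _ * X]xL mulrA -[X in _ = _ * X * _]powRr1 //.
  rewrite mulrC; congr (_ * _).
  have [h|h] := eqVneq (x i / N x) 0.
    by rewrite h powR0 // powRr1 ?mulr0.
  by rewrite -powRD ?h ?implybT // subrK.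
Qed.

Section LpDual.
Variables (R : realType) (k : scalar_kind) (p : \bar R).
Hypothesis hp : (1%:E <= p)%E.
Notation K := (scalar_field R k).
Notation sabs := (@scalar_abs R k).
Implicit Types (E : seq nat) (c d : nat -> K).

Lemma lp_norm_support E E' c d : uniq E -> uniq E' ->
  (forall i, i \in E -> c i != 0 -> i \in E' /\ sabs (c i) = sabs (d i)) ->
  lp_norm p E c <= lp_norm p E' d.
Proof.
move=> uE uE' h; have := @lp_norm_ge0 R k p E' d.
rewrite /lp_norm; case: p hp => [r|h1|h1]; last by [].
- rewrite lee_fin => r1 _.
  have r0 : 0 < r by apply: lt_le_trans r1.
  rewrite ge0_ler_powR ?invr_ge0 ?(ltW r0) // ?nnegrE;
    try by apply: sumr_ge0 => i _; apply: powR_ge0.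
  apply: ler_sum_support => // [i _|i iE]; first exact: powR_ge0.
  move=> ci; have ci0 : c i != 0.
    apply: contra_neq ci => ->; rewrite scalar_abs0 powR0 //.
    exact: lt0r_neq0.
  by have [-> ->] := h i iE ci0.
- move=> N0; rewrite big_seq; apply: bigmax_le => // i iE.
  have [->|ci0] := eqVneq (c i) 0; first by rewrite scalar_abs0.
  by have [iE' ->] := h i iE ci0; exact: (@le_bigmax_seq _ _ _ E' 0 i predT (fun i => sabs (d i))).
Qed.

Lemma le_lp_norm E c i : uniq E -> i \in E -> sabs (c i) <= lp_norm p E c.
Proof.
move=> uE iE; rewrite -(@lp_norm_single R k p hp [:: i] c i) ?mem_head //.
  apply: lp_norm_support => // j; rewrite inE => /eqP-> _; split=> //.
by move=> j; rewrite inE => /eqP->; rewrite eqxx.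
Qed.

(** The finite case is Hölder's inequality. When [p] is infinite, the dual
    vector is a coordinate functional at an index where the maximum is attained. *)
Lemma lp_dual_vector E c : uniq E -> exists v : nat -> R,
  [/\ forall i, 0 <= v i,
      forall d, \sum_(i <- E) v i * sabs (d i) <= lp_norm p E d
    & lp_norm p E c <= \sum_(i <- E) v i * sabs (c i)].
Proof.
move=> uE; have := @le_lp_norm E; rewrite /lp_norm.
case: p hp => [r|h1|h1]; last by [].
  rewrite lee_fin => r1 _.
  have [v [v0 vle vge]] := @powR_dual_vector R r E (fun i => sabs (c i)) r1
    (fun i => scalar_abs_ge0 (c i)).
  exists v; split; first exact: v0.
    by move=> d; apply: vle => i; apply: scalar_abs_ge0.
  by rewrite vge lexx.
move=> lec; case: (eqVneq (\big[Num.max/0]_(i <- E) sabs (c i)) 0) => L0.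
  exists (fun=> 0); split.
  - by move=> i; apply: lexx.
  - move=> d; rewrite big1; last by move=> i _; rewrite mul0r.
    by apply: (@lp_norm_ge0 R k +oo%E).
  - by rewrite L0 big1 ?lexx // => i _; rewrite mul0r.
have [i iE ci] : exists2 i, i \in E &
    \big[Num.max/0]_(i <- E) sabs (c i) = sabs (c i).
  move: L0; rewrite big_seq; elim/big_ind: _.
  - by rewrite eqxx.
  - by move=> x y hx hy; case: (leP x y) => _; [exact: hy|exact: hx].
  - by move=> i iE _; exists i.
have single d : \sum_(j <- E) (j == i)%:R * sabs (d j) = sabs (d i).
  rewrite (bigD1_seq i) //= eqxx mul1r big1 ?addr0 //.
  by move=> j /negPf->; rewrite mul0r.
exists (fun j => (j == i)%:R); split.
- by move=> j; apply: ler0n.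
- by move=> d; rewrite single; apply: lec.
- by rewrite single ci lexx.
Qed.

End LpDual.

(** * The operator attached to a well-founded tree *)

Lemma pairing_filter_le (R : realType) (k : scalar_kind) (I : Type)
    (w : seq (I * R)) (a b : pred I) (f : I -> scalar_field R k) :
  nonneg_weight w -> (forall t, a t -> f t != 0 -> b t) ->
  pairing [seq tw <- w | a tw.1] f <= pairing [seq tw <- w | b tw.1] f.
Proof.
move=> w0 ab; rewrite /pairing !big_filter.
elim: w w0 => [|tw w IH] /=; first by rewrite !big_nil.
move=> /andP[tw0 /IH {}IH]; rewrite !big_cons.
have h0 : 0 <= tw.2 * scalar_abs (f tw.1) by rewrite mulr_ge0 // scalar_abs_ge0.
have [->|f0] := eqVneq (f tw.1) 0.
  by rewrite scalar_abs0 mulr0 !add0r; case: ifP; case: ifP.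
case: ifP => [/ab/(_ f0)->|_]; first by rewrite lerD2l.
case: ifP => // _; apply: le_trans IH _; by rewrite lerDr.
Qed.

Lemma lp_norm_nil (R : realType) (k : scalar_kind) (p : \bar R)
    (c : nat -> scalar_field R k) : (1%:E <= p)%E -> lp_norm p [::] c = 0.
Proof.
rewrite /lp_norm; case: p => [r|h|h]; rewrite ?big_nil //.
rewrite lee_fin => r1; rewrite powR0 // invr_neq0 //.
by apply: lt0r_neq0; apply: lt_le_trans r1.
Qed.

Section TreeSpace.
Variables (R : realType) (k : scalar_kind) (p : \bar R).
Hypothesis hp : (1%:E <= p)%E.
Variables (D : eqType) (P : pred (seq D)).
Hypothesis P_nil : P [::].
Hypothesis P_prefix : forall s t, prefix s t -> P t -> P s.
Notation K := (scalar_field R k).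
Notation sabs := (@scalar_abs R k).
Implicit Types (s t : seq D) (w : seq (seq D * R)) (c f : seq D -> K).

Definition branch_norm s c : R :=
  lp_norm p (iota 0 (size s).+1) (fun i => c (take i s)).

Lemma branch_norm_ge0 s c : 0 <= branch_norm s c.
Proof. exact: lp_norm_ge0. Qed.

Definition along s w := [seq tw <- w | prefix tw.1 s].

(** The weights whose restriction to each branch of [P] is in the polar of
    the unit ball of l_p. Weights outside [P] are unrestricted, which
    forces the functions of the space to vanish there. *)
Definition tree_weights : set (seq (seq D * R)) :=
  [set w | nonneg_weight w /\
     forall s, P s -> forall c, pairing (along s w) c <= branch_norm s c].

Lemma nonneg_weight_filter (a : pred (seq D * R)) w :
  nonneg_weight w -> nonneg_weight [seq tw <- w | a tw].
Proof. by move=> w0; rewrite /nonneg_weight all_filter; apply: sub_all w0 => tw /= ->; rewrite implybT. Qed.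

Lemma tree_weights_filter (a : pred (seq D)) w :
  tree_weights w -> tree_weights [seq tw <- w | a tw.1].
Proof.
move=> [w0 hw]; split; first exact: nonneg_weight_filter.
move=> s Ps c; apply: le_trans (hw s Ps c).
rewrite /along -filter_predI.
refine (@pairing_filter_le R k _ w (fun t => prefix t s && a t)
  (fun t => prefix t s) c w0 _).
by move=> t /andP[].
Qed.

Lemma tree_weights_nil : tree_weights [::].
Proof.
by split=> // s _ c; rewrite /along /= /pairing big_nil branch_norm_ge0.
Qed.

Lemma tree_weights_point t : tree_weights [:: (t, 1)].
Proof.
split; first by rewrite /nonneg_weight /= ler01.
move=> s _ c; rewrite /along /=; case: ifP => ts; last first.
  by rewrite /pairing big_nil branch_norm_ge0.
rewrite /pairing big_seq1 /= mul1r.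
move: (ts); rewrite prefixE => /eqP tE; rewrite -{1}tE.
apply: (le_lp_norm hp (fun i => c (take i s))); first exact: iota_uniq.
by rewrite mem_iota /= ltnS; apply: size_prefix.
Qed.

Definition tree_weight_system : weight_system R (seq D) :=
  @WeightSystem R (seq D) tree_weights (fun w hw => hw.1)
    tree_weights_nil tree_weights_point.

(** Weights concentrated on a single branch of [P]: they yield the supremum
    over all branches of the l_p norm along the branch. *)
Definition branch_weights : set (seq (seq D * R)) :=
  [set w | tree_weights w /\
     exists2 s, P s & all (fun tw => P tw.1 ==> prefix tw.1 s) w].

Lemma branch_weights_nil : branch_weights [::].
Proof. by split; [exact: tree_weights_nil|exists [::]]. Qed.

Lemma branch_weights_point t : branch_weights [:: (t, 1)].
Proof.
split; first exact: tree_weights_point.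
case: (boolP (P t)) => Pt.
  by exists t; rewrite //= prefix_refl implybT.
by exists [::]; rewrite //= (negPf Pt).
Qed.

Definition branch_weight_system : weight_system R (seq D) :=
  @WeightSystem R (seq D) branch_weights (fun w hw => hw.1.1)
    branch_weights_nil branch_weights_point.

Definition tree_space := weight_space k tree_weight_system.
Definition branch_space := weight_space k branch_weight_system.

Lemma tree_bounded_branch f :
  f \in wbounded (k:=k) tree_weight_system -> f \in wbounded (k:=k) branch_weight_system.
Proof. by move=> /asboolP[M hM]; apply/asboolP; exists M => w [/hM]. Qed.

Definition tree_to_branch_fun (f : tree_space) : branch_space :=
  WSpace (tree_bounded_branch (valP f)).

Lemma tree_to_branch_linear : linear tree_to_branch_fun.
Proof. by move=> a f g; apply/val_inj. Qed.

HB.instance Definition _ := GRing.isLinear.Build K tree_space branch_space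
  *:%R tree_to_branch_fun tree_to_branch_linear.

Lemma tree_to_branch_norm (f : tree_space) : rnorm (tree_to_branch_fun f) <= rnorm f.
Proof.
rewrite !rnorm_wspace; apply: wnorm_le => w [hw _].
exact: (@wnorm_ub _ _ _ tree_weight_system f w hw).
Qed.

Lemma tree_to_branch_bounded : bounded_near tree_to_branch_fun (nbhs (0 : tree_space)).
Proof.
apply/linear_boundedP; near=> r => f.
rewrite !rnormE; apply: le_trans (_ : scalar_of_real k (rnorm f) <= _).
  by rewrite ler_scalar_of_real tree_to_branch_norm.
rewrite -rnormE -[leLHS]mul1r ler_wpM2r //.
Unshelve. all: by end_near. Qed.

Definition tree_operator : operator tree_space branch_space :=
  Operator tree_to_branch_bounded.

(** * Branches of the tree span l_p spaces *)

Lemma pairing_branch_le s w f : P s -> tree_weights w ->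
  (forall t, f t != 0 -> prefix t s) -> pairing w f <= branch_norm s f.
Proof.
move=> Ps [w0 hw] fs; apply: le_trans (hw s Ps f).
rewrite -{1}[w]filter_predT.
refine (@pairing_filter_le R k _ w predT (fun t => prefix t s) f w0 _).
by move=> t _; apply: fs.
Qed.

(** The dual vector of [f] along the prefixes of [s], placed on those
    prefixes, is admissible: any other branch shares with [s] an initial
    segment of the prefixes. *)
Lemma branch_norming s f : P s ->
  exists2 w, branch_weights w & branch_norm s f <= pairing w f.
Proof.
move=> Ps.
have [v [v0 vle vge]] := lp_dual_vector hp (fun i => f (take i s))
  (iota_uniq 0 (size s).+1).
have pairingE c (a : pred (seq D)) :
    pairing [seq tw <- [seq (take i s, v i) | i <- iota 0 (size s).+1] | a tw.1] c =
    \sum_(i <- iota 0 (size s).+1 | a (take i s)) v i * sabs (c (take i s)).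
  by rewrite /pairing big_filter big_map.
exists [seq (take i s, v i) | i <- iota 0 (size s).+1]; last first.
  apply: le_trans vge _; have := pairingE f predT.
  by rewrite filter_predT => ->.
split; last first.
  exists s => //; apply/allP => _ /mapP[i _ ->] /=.
  by rewrite prefix_take implybT.
split; first by apply/allP => _ /mapP[i _ ->] /=; apply: v0.
move=> s' Ps' c; rewrite /along (pairingE c (fun t => prefix t s')).
pose d i := if prefix (take i s) s' then c (take i s) else 0.
have -> : \sum_(i <- iota 0 (size s).+1 | prefix (take i s) s')
      v i * sabs (c (take i s)) =
    \sum_(i <- iota 0 (size s).+1) v i * sabs (d i).
  rewrite big_mkcond; apply: eq_bigr => i _; rewrite /d.
  by case: ifP => // _; rewrite scalar_abs0 mulr0.
apply: le_trans (vle d) _.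
apply: lp_norm_support => //; [exact: iota_uniq|exact: iota_uniq|].
move=> i; rewrite !mem_iota /= !add0n !ltnS => is_; rewrite /d; case: ifP; last first.
  by rewrite eqxx.
move=> pis' _; have := size_prefix pis'; rewrite size_takel // => is'.
split=> //; congr (sabs (c _)).
by move: pis'; rewrite prefixE size_takel // => /eqP.
Qed.

Definition delta t : seq D -> K := fun t' => (t' == t)%:R.

Lemma delta_bounded t : P t -> delta t \in wbounded (k:=k) tree_weight_system.
Proof.
move=> Pt; apply/asboolP; exists (branch_norm t (delta t)) => w hw.
apply: pairing_branch_le => // t'; rewrite /delta.
by have [->|_] := eqVneq t' t; rewrite ?prefix_refl // eqxx.
Qed.

Definition tree_basis t : tree_space :=
  insubd (0 : wspace k tree_weight_system) (delta t).

Lemma tree_basisE t t' : P t -> tree_basis t t' = (t' == t)%:R.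
Proof. by move=> Pt; apply: (congr1 (@^~ t') (insubdK 0 (delta_bounded Pt))). Qed.

Lemma tree_spaceZ a (f : tree_space) t : (a *: f) t = a * f t.
Proof. by []. Qed.

Definition branch_seq s : seq tree_space :=
  mkseq (fun i => tree_basis (take i s)) (size s).+1.

Lemma tree_space_sum (J : Type) (r : seq J) (F : J -> tree_space) t :
  (\sum_(j <- r) F j) t = \sum_(j <- r) F j t.
Proof. by elim/big_rec2: _ => // j a b _ <-. Qed.

Lemma branch_seq_lp_tree s : P s -> lp_tree p tree_operator 1 (branch_seq s).
Proof.
move=> Ps.
have Ptake i : P (take i s) by apply: P_prefix Ps; apply: prefix_take.
have nthE i : i \in iota 0 (size s).+1 -> (branch_seq s)`_i = tree_basis (take i s).
  by rewrite mem_iota /= add0n => iE; rewrite nth_mkseq.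
pose f (c : nat -> K) : tree_space :=
  \sum_(i <- iota 0 (size s).+1) c i *: tree_basis (take i s).
have take_inj i j : (i <= size s)%N -> (j <= size s)%N ->
    (take i s == take j s) = (i == j).
  move=> is_ js; apply/eqP/eqP => [/(congr1 size)|->//].
  by rewrite !size_takel.
have fE (c : nat -> K) i : i \in iota 0 (size s).+1 -> f c (take i s) = c i.
  rewrite mem_iota /= add0n ltnS => is_; rewrite tree_space_sum.
  rewrite (bigD1_seq i) ?iota_uniq ?mem_iota ?add0n ?ltnS // tree_spaceZ tree_basisE //.
  rewrite eqxx mulr1 big_seq_cond big1; first by rewrite /= addr0.
  move=> j /andP[+ ji]; rewrite mem_iota add0n ltnS => /andP[_ js].
  by rewrite tree_spaceZ tree_basisE // take_inj // eq_sym (negPf ji) mulr0.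
have f0 (c : nat -> K) t : f c t != 0 -> prefix t s.
  apply: contraNT => ts; rewrite tree_space_sum big1 // => i _.
  rewrite tree_spaceZ tree_basisE //; have [tE|_] := eqVneq t (take i s); last by rewrite mulr0.
  by rewrite tE prefix_take in ts.
have branchE (c : nat -> K) : branch_norm s (f c) = lp_norm p (iota 0 (size s).+1) c.
  by apply: lp_norm_abs => i iE; rewrite fE.
have f_le (c : nat -> K) : rnorm (f c) <= lp_norm p (iota 0 (size s).+1) c.
  rewrite rnorm_wspace -branchE; apply: wnorm_le => w hw.
  by apply: pairing_branch_le => //; apply: f0.
have szE : size (branch_seq s) = (size s).+1 by rewrite size_mkseq.
split; rewrite ?szE.
- move=> x /mapP[i iE ->].
  pose c (j : nat) : K := (j == i)%:R.
  have <- : f c = tree_basis (take i s).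
    rewrite /f (bigD1_seq i) ?iota_uniq //= /c eqxx scale1r big1 ?addr0 //.
    by move=> j /negPf->; rewrite scale0r.
  apply: le_trans (f_le c) _.
  rewrite (@lp_norm_single _ _ _ hp _ _ i) ?iota_uniq //.
    by rewrite /c eqxx scalar_abs1.
  by move=> j _ /negPf; rewrite /c => ->.
- move=> c; rewrite mul1r; apply: le_trans (f_le c).
  by rewrite (eq_comb_norm _ nthE).
- move=> c; rewrite mul1r -branchE.
  rewrite (@eq_comb_norm _ _ _ _ (fun i => tree_operator (tree_basis (take i s)))).
    have -> : comb_norm (fun i => tree_operator (tree_basis (take i s)))
        (iota 0 (size s).+1) c = rnorm (tree_operator (f c)).
      rewrite /comb_norm /f linear_sum; congr rnorm.
      by apply: eq_bigr => i _; rewrite linearZ.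
    have [w hw wf] := branch_norming (f c) Ps.
    apply: le_trans wf _; rewrite rnorm_wspace.
    exact: (@wnorm_ub _ _ _ branch_weight_system (tree_operator (f c)) w hw).
  by move=> i /nthE->.
Qed.

(** A node [s] is sent to the basis vectors of all its prefixes, the root
    included; so the empty sequence is not in the image, and is recovered as
    an initial segment of the image of the root. *)
Lemma tree_operator_not_NP x :
  tree_deriv_iter [set s | P s] (omega_pow x) [::] ->
  ~ NP_class p x tree_operator.
Proof.
move=> h; apply: (@not_NP_class _ _ _ _ _ _ 1) => //.
have h' := @tree_deriv_iter_image _ _ branch_seq [set s | P s]
  (lp_tree p tree_operator 1) (omega_pow x).
apply: tree_deriv_iter_nil (h' _ branch_seq_lp_tree [::] h).
  split=> // c; rewrite /= mul1r.
  - by rewrite /comb_norm big_nil rnorm0 lp_norm_ge0.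
  - by rewrite lp_norm_nil // rnorm_ge0.
move=> s t _ _ /prefixP[t' ->] ts; split.
  apply/prefixP; exists (drop (size s).+1 (branch_seq (s ++ t'))).
  rewrite -[LHS](cat_take_drop (size s).+1); congr (_ ++ _).
  rewrite /branch_seq /mkseq -map_take take_iota size_cat.
  rewrite (minn_idPl _) ?ltnS ?leq_addr //; apply/eq_in_map => i.
  by rewrite mem_iota /= add0n ltnS => is_; rewrite takel_cat.
move=> /(congr1 size)/eqP; rewrite !size_mkseq size_cat eqSS -[X in _ == X]addn0.
by rewrite eqn_add2l => /nilP t'0; rewrite t'0 cats0 in ts.
Qed.

End TreeSpace.

(** * The case p > 1: norm convergence of Cesàro-null sequences *)

Lemma frequently_list (Q : nat -> Prop) : (forall J, exists2 j, (J <= j)%N & Q j) ->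
  forall n M, exists E : seq nat,
    [/\ sorted ltn E, size E = n, all (leq M) E & forall i, i \in E -> Q i].
Proof.
move=> hQ n; elim: n => [|n IH] M; first by exists [::].
have [j Mj Qj] := hQ M; have [E [sE szE jE QE]] := IH j.+1.
exists (j :: E); split=> /=; rewrite ?szE ?Mj //.
- by case: E sE jE {szE QE} => //= a E -> /andP[->].
- by apply: sub_all jE => i /ltnW; apply: leq_trans.
- by move=> i; rewrite inE => /orP[/eqP->//|/QE].
Qed.

Section TreeSpaceCesaro.
Variables (R : realType) (k : scalar_kind) (p : \bar R).
Hypothesis hp : (1%:E <= p)%E.
Variables (D : eqType) (P : pred (seq D)).
Hypothesis P_nil : P [::].
Hypothesis P_prefix : forall s t, prefix s t -> P t -> P s.
Hypothesis P_wf : well_founded (fun t s => [&& P t, prefix s t & t != s]).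
Notation K := (scalar_field R k).
Notation sabs := (@scalar_abs R k).
Notation space := (@tree_space R k p hp D P).
Notation weight := (@tree_weights R k p D P).
Implicit Types (s t : seq D) (w : seq (seq D * R)) (f g : space) (A : pred (seq D)).

Definition restrict A w := [seq tw <- w | A tw.1].

Definition part_norm A f : R := sup [set pairing (restrict A w) f | w in weight].

Lemma part_norm_has_sup A f : has_sup [set pairing (restrict A w) f | w in weight].
Proof.
split; first by exists (pairing [::] f); exists [::] => //; apply: tree_weights_nil.
exists (wnorm f) => _ [w hw <-].
exact: (@wnorm_ub _ _ _ (tree_weight_system k hp P) f _ (tree_weights_filter A hw)).
Qed.

Lemma part_norm_ub A f w : weight w -> pairing (restrict A w) f <= part_norm A f.
Proof.
by move=> hw; apply: ub_le_sup; [case: (part_norm_has_sup A f)|exists w].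
Qed.

Lemma part_norm_le A f M :
  (forall w, weight w -> pairing (restrict A w) f <= M) -> part_norm A f <= M.
Proof.
move=> hM; apply: ge_sup; first by case: (part_norm_has_sup A f).
by move=> _ [w Ww <-]; apply: hM.
Qed.

Lemma restrict_id A w : all (fun tw => A tw.1) w -> restrict A w = w.
Proof. by move=> /all_filterP. Qed.

Lemma part_norm_approx A f e : 0 < e -> exists w,
  [/\ weight w, all (fun tw => A tw.1) w & part_norm A f - e < pairing w f].
Proof.
move=> e0; have [_ [w Ww <-] h] := sup_adherent e0 (part_norm_has_sup A f).
exists (restrict A w); split=> //; first exact: tree_weights_filter.
exact: filter_all.
Qed.

Lemma part_norm_wnorm A f : part_norm A f <= wnorm f.
Proof.
apply: part_norm_le => w hw.
exact: (@wnorm_ub _ _ _ (tree_weight_system k hp P) f _ (tree_weights_filter A hw)).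
Qed.

Lemma pairing_restrictC A w (f : seq D -> K) :
  pairing w f = pairing (restrict A w) f + pairing (restrict (predC A) w) f.
Proof. by rewrite /pairing !big_filter (bigID (fun tw => A tw.1)). Qed.

(** * Sibling subtrees are l_1-independent *)

Lemma pairing_cover (C : seq (seq D)) (B : seq D -> pred (seq D)) w
    (f : seq D -> K) :
  nonneg_weight w -> (forall tw, tw \in w -> exists2 c, c \in C & B c tw.1) ->
  pairing w f <= \sum_(c <- C) pairing (restrict (B c) w) f.
Proof.
move=> w0 wC.
rewrite (eq_bigr (fun c => \sum_(tw <- w | B c tw.1) tw.2 * sabs (f tw.1))); last first.
  by move=> c _; rewrite /pairing big_filter.
rewrite (exchange_big_dep predT) //= /pairing.
rewrite big_seq [leRHS]big_seq; apply: ler_sum => tw tww.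
have h0 : 0 <= tw.2 * sabs (f tw.1).
  by rewrite mulr_ge0 ?scalar_abs_ge0 // (allP w0 _ tww).
have [c cC Bc] := wC tw tww.
by rewrite (big_rem c cC) /= Bc lerDl sumr_ge0.
Qed.

Definition at_above s t := P t && prefix s t.
Definition above s t := [&& P t, prefix s t & t != s].

(** For [t] strictly above [s], this is the immediate successor of [s] on the
    way to [t]. *)
Definition child s t := take (size s).+1 t.

Lemma above_size s t : above s t -> (size s < size t)%N.
Proof.
move=> /and3P[_ /prefixP[t' ->] ts]; rewrite size_cat -addn1 leq_add2l lt0n.
by apply: contra ts => /nilP->; rewrite cats0.
Qed.

Lemma above_child s t : above s t -> above s (child s t) /\ at_above (child s t) t.
Proof.
move=> h; have := above_size h; case/and3P: h => Pt st ts szt.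
have pc : prefix (child s t) t := prefix_take _ _.
split; last by rewrite /at_above Pt.
have szc : size (child s t) = (size s).+1 by rewrite size_takel.
apply/and3P; split; first exact: P_prefix pc Pt.
- by move: st; rewrite !prefixE /child take_takel.
- by apply/eqP => /(congr1 size)/eqP; rewrite szc (gtn_eqF (ltnSn _)).
Qed.

Lemma child_eq s t t' : above s t -> prefix t t' -> child s t = child s t'.
Proof.
move=> /above_size szt /prefixP[t1 ->].
by rewrite /child takel_cat.
Qed.

(** Weights above [s] meeting disjoint sets of immediate successors of [s]
    can be added, as no branch of the tree meets both. *)
Lemma weight_cat s (C : seq (seq D)) w w' : weight w -> weight w' ->
  all (fun tw => above s tw.1) w -> all (fun tw => above s tw.1) w' ->
  (forall tw, tw \in w -> child s tw.1 \in C) ->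
  (forall tw, tw \in w' -> child s tw.1 \notin C) -> weight (w ++ w').
Proof.
move=> [w0 hw] [w'0 hw'] sw sw' wC w'C; split.
  by rewrite /nonneg_weight all_cat; apply/andP.
move=> z Pz c; rewrite /along filter_cat pairing_cat.
have [/hasP[tw tww twz]|] := boolP (has (fun tw => prefix tw.1 z) w); last first.
  rewrite has_filter negbK => /eqP->.
  by rewrite {1}/pairing big_nil add0r; apply: hw'.
have -> : [seq tw <- w' | prefix tw.1 z] = [::].
  apply/eqP; rewrite -[_ == _]negbK -has_filter; apply/hasPn => tw' tww'.
  apply/negP => twz'; have := w'C _ tww'.
  rewrite (child_eq (allP sw' _ tww') twz') -(child_eq (allP sw _ tww) twz).
  by rewrite wC.
by rewrite /pairing big_nil addr0; apply: hw.
Qed.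

(** On the part strictly above [s] the norm is asymptotically additive along
    a sequence that tends to 0 in norm on the subtree of each immediate
    successor of [s]: a norming weight for [f] only meets finitely many of
    these subtrees, and can be completed off them by a norming weight for
    [g j]. *)
Lemma above_norm_additive s f (g : nat -> space) :
  (forall t, above s t -> forall e, 0 < e ->
     exists J, forall j, (J <= j)%N -> part_norm (at_above (child s t)) (g j) <= e) ->
  forall e, 0 < e -> exists J, forall j, (J <= j)%N ->
    part_norm (above s) f + part_norm (above s) (g j) - e <=
    part_norm (above s) (f + g j).
Proof.
move=> hg e e0; pose e5 := e / 5.
have e50 : 0 < e5 by rewrite divr_gt0.
have [w [hw sw wf]] := part_norm_approx (above s) f e50.
pose C := [seq child s tw.1 | tw <- w].
have C_above c : c \in C -> exists2 t, above s t & c = child s t.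
  by move=> /mapP[tw tww ->]; exists tw.1 => //; apply: (allP sw _ tww).
pose d := e5 / (size C).+1%:R.
have d0 : 0 < d by rewrite divr_gt0.
have [J hJ] : exists J, forall j c, (J <= j)%N -> c \in C ->
    part_norm (at_above c) (g j) <= d.
  elim: {d C_above}(C) (C_above) (d) d0 => [|c C' IH] hC d d0; first by exists 0%N.
  have [J1 h1] := IH (fun c' hc' => hC c' (@mem_behead _ (c :: C') c' hc')) d d0.
  have [t st ct] := hC c (mem_head _ _).
  have [J2 h2] := hg t st d d0.
  exists (maxn J1 J2) => j c'; rewrite geq_max => /andP[j1 j2].
  by rewrite inE => /orP[/eqP->|/h1]; [rewrite ct; apply: h2|apply].
exists J => j jJ.
(* The part of an admissible weight over the subtrees in [C] is negligible. *)
have small w1 : weight w1 -> all (fun tw => above s tw.1) w1 ->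
    (forall tw, tw \in w1 -> child s tw.1 \in C) -> pairing w1 (g j) <= e5.
  move=> hw1 sw1 w1C.
  apply: le_trans (_ : \sum_(c <- C) pairing (restrict (at_above c) w1) (g j) <= _).
    apply: pairing_cover; first exact: hw1.1.
    move=> tw tww; exists (child s tw.1); first exact: w1C.
    by have [] := above_child (allP sw1 _ tww).
  apply: le_trans (_ : \sum_(c <- C) d <= _).
    rewrite big_seq [leRHS]big_seq; apply: ler_sum => c cC.
    by apply: le_trans (part_norm_ub _ _ hw1) (hJ _ _ jJ cC).
  rewrite big_const_seq count_predT iter_addr addr0 -mulr_natl /d mulrCA.
  rewrite ler_piMr ?(ltW e50) //.
  by rewrite ler_pdivrMr ?ltr0n // mul1r ler_nat leqnSn.
have [w1 [hw1 sw1 w1g]] := part_norm_approx (above s) (g j) e50.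
pose inC : pred (seq D) := fun t => child s t \in C.
pose w2 := restrict (predC inC) w1.
have hw2 : weight w2 by apply: tree_weights_filter.
have sw2 : all (fun tw => above s tw.1) w2.
  by apply/allP => tw; rewrite mem_filter => /andP[_ /(allP sw1)].
have w2g : part_norm (above s) (g j) - e5 - e5 <= pairing w2 (g j).
  have := small _ (tree_weights_filter inC hw1).
  have := pairing_restrictC inC w1 (g j); rewrite -/w2 => E.
  move=> /(_ _ _)h; have {h} : pairing (restrict inC w1) (g j) <= e5.
    apply: h; last by move=> tw; rewrite mem_filter => /andP[].
    by apply/allP => tw; rewrite mem_filter => /andP[_ /(allP sw1)].
  by move: w1g; rewrite E; lra.
have hw3 : weight (w ++ w2).
  apply: (weight_cat hw hw2 sw sw2 (C := C)).
    by move=> tw tww; apply: map_f.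
  by move=> tw; rewrite mem_filter => /andP[].
have sw3 : all (fun tw => above s tw.1) (w ++ w2) by rewrite all_cat sw.
have h1 := part_norm_ub (above s) (f + g j) hw3.
have h2 := part_norm_ub (above s) f hw3.
rewrite (restrict_id sw3) !pairing_cat in h1 h2.
have h3 : pairing w f <= pairing w (f + g j) + pairing w (g j).
  apply: ler_pairingD; first exact: hw.1.
  move=> t; rewrite -[sabs (g j t)]scalar_absN.
  by rewrite -[f t](addrK (g j t)) ler_scalar_absD.
have h4 : pairing w2 (g j) <= pairing w2 (f + g j) + pairing w2 f.
  apply: ler_pairingD; first exact: hw2.1.
  move=> t; rewrite -[sabs (f t)]scalar_absN.
  by rewrite -[g j t](addKr (f t)) addrC ler_scalar_absD.
have h5 : pairing w (g j) <= e5.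
  by apply: small => // tw tww; apply: map_f.
have e5E : e = e5 + e5 + e5 + e5 + e5 by rewrite /e5; field.
by move: h1 h2 h3 h4 h5 w2g wf; rewrite e5E; lra.
Qed.

(** * Cesàro-null sequences *)

Definition cesaro_null (u : nat -> space) := forall e, 0 < e ->
  exists n M, (0 < n)%N /\ forall E : seq nat, sorted ltn E -> size E = n ->
    all (leq M) E -> forall c : nat -> K, (forall i, sabs (c i) = 1) ->
    wnorm (\sum_(i <- E) c i *: u i) <= e * n%:R.

(** Unimodular factors make the values at [t] positive, and then nothing
    cancels in the sums. *)
Lemma cesaro_null_coord (u : nat -> space) t : cesaro_null u ->
  forall e, 0 < e -> exists J, forall j, (J <= j)%N -> sabs (u j t) <= e.
Proof.
move=> hu e e0; apply: contrapT => hJ.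
have freq J : exists2 j, (J <= j)%N & e < sabs (u j t).
  apply: contrapT => h; apply: hJ; exists J => j Jj.
  by rewrite leNgt; apply/negP => h'; apply: h; exists j.
have [n [M [n0 hn]]] := hu (e / 2) (divr_gt0 e0 (ltr0Sn _ _)).
have [E [sE szE ME hE]] := frequently_list freq n M.
pose c i := projT1 (cid2 (scalar_align (u i t))).
have c1 i : sabs (c i) = 1 by rewrite /c; case: cid2.
have cu i : c i * u i t = scalar_of_real k (sabs (u i t)).
  by rewrite /c; case: cid2.
have := hn E sE szE ME c c1.
have sumE : sabs ((\sum_(i <- E) c i *: u i) t) = \sum_(i <- E) sabs (u i t).
  rewrite tree_space_sum.
  have -> : \sum_(i <- E) (c i *: u i) t =
      scalar_of_real k (\sum_(i <- E) sabs (u i t)).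
    elim: (E) => [|i E' IH]; first by rewrite !big_nil scalar_of_real0.
    by rewrite !big_cons scalar_of_realD IH -cu.
  rewrite scalar_abs_real ger0_norm // sumr_ge0 // => i _.
  exact: scalar_abs_ge0.
have := wnorm_point (\sum_(i <- E) c i *: u i) t.
rewrite sumE => h1 h2.
have h3 : n%:R * e <= \sum_(i <- E) sabs (u i t).
  rewrite -szE -sum1_size natr_sum mulr_suml big_seq [leRHS]big_seq.
  by apply: ler_sum => i iE; rewrite mul1r ltW // hE.
have n0' : 0 < n%:R :> R by rewrite ltr0n.
by have := le_trans h3 (le_trans h1 h2); nra.
Qed.

Lemma pairing_point_le w s f : P s -> weight w ->
  pairing (restrict (pred1 s) w) f <= sabs (f s).
Proof.
move=> Ps hw; pose g := fun t => if t == s then f t else 0.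
have -> : pairing (restrict (pred1 s) w) f = pairing (restrict (pred1 s) w) g.
  rewrite /pairing !big_filter; apply: eq_bigr => tw /eqP tws.
  by rewrite /g tws eqxx.
apply: le_trans (_ : branch_norm p s g <= _).
  apply: (pairing_branch_le Ps (tree_weights_filter (pred1 s) hw)).
  move=> t; rewrite /g; have [->|_] := eqVneq t s; first by rewrite prefix_refl.
  by rewrite eqxx.
rewrite /branch_norm (@lp_norm_single _ _ _ hp _ _ (size s)) ?iota_uniq //.
- by rewrite take_size /g eqxx.
- by rewrite mem_iota /= add0n ltnSn.
- move=> j; rewrite mem_iota /= add0n ltnS => js jn; rewrite /g.
  case: eqP => // /(congr1 size); rewrite size_takel // => jE.
  by rewrite jE eqxx in jn.
Qed.

(** By induction on the tree, a Cesàro-null sequence tends to 0 in norm on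
    every subtree; this is the argument by which l_1-sums of spaces with the
    Schur property have the Schur property. *)
Lemma cesaro_null_part (u : nat -> space) : cesaro_null u ->
  forall s, P s -> forall e, 0 < e ->
  exists J, forall j, (J <= j)%N -> part_norm (at_above s) (u j) <= e.
Proof.
move=> hu; elim/(well_founded_ind P_wf) => s IH Ps.
have IHc t : above s t -> forall e, 0 < e -> exists J, forall j, (J <= j)%N ->
    part_norm (at_above (child s t)) (u j) <= e.
  move=> /above_child[hc _]; apply: IH; first exact: hc.
  by case/and3P: hc.
have part_above e : 0 < e -> exists J, forall j, (J <= j)%N ->
    part_norm (above s) (u j) <= e.
  move=> e0; apply: contrapT => hJ.
  have freq J : exists2 j, (J <= j)%N & e < part_norm (above s) (u j).
    apply: contrapT => h; apply: hJ; exists J => j Jj.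
    by rewrite leNgt; apply/negP => h'; apply: h; exists j.
  have [n [M [n0 hn]]] := hu (e / 2) (divr_gt0 e0 (ltr0Sn _ _)).
  (* Each further index adds more than [e], up to an error [e / 4], whereas
     Cesàro-nullity allows only [e / 2] per index. *)
  have [E [sE szE ME hE]] : exists E, [/\ sorted ltn (rev E), size E = n,
      all (leq M) E & n%:R * (3 / 4 * e) <=
        part_norm (above s) (\sum_(i <- E) u i)].
    elim: (n) => [|m [E [sE szE ME hE]]].
      exists [::]; split=> //; rewrite mul0r.
      apply: le_trans (part_norm_ub (above s) _ (tree_weights_nil k p P)).
      by rewrite /pairing big_nil.
    have [J hJ'] := above_norm_additive (\sum_(i <- E) u i) IHc
      (divr_gt0 e0 (ltr0Sn _ 3)).
    have [j jJ hj] := freq (maxn J (maxn M (head 0%N E).+1)).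
    move: jJ; rewrite !geq_max => /and3P[jJ jM jE].
    exists (j :: E); split.
    - move: sE; rewrite !rev_sorted; case: E jE {szE ME hE hJ'} => //= a E jE.
      by move=> ->; rewrite jE.
    - by rewrite /= szE.
    - by rewrite /= jM.
    - rewrite big_cons addrC; apply: le_trans (hJ' j jJ).
      by rewrite -natr1; lra.
  have := hn (rev E) sE _ _ (fun=> 1) (fun=> scalar_abs1 R k).
  rewrite size_rev all_rev => /(_ szE ME).
  rewrite (eq_bigr u) => [|i _]; last by rewrite scale1r.
  rewrite (perm_big E) ?perm_rev //= => h.
  have n0' : 0 < n%:R :> R by rewrite ltr0n.
  by have := le_trans hE (le_trans (part_norm_wnorm _ _) h); nra.
move=> e e0; have e2 : 0 < e / 2 by rewrite divr_gt0.
have [J1 h1] := part_above _ e2.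
have [J2 h2] := cesaro_null_coord s hu e2.
exists (maxn J1 J2) => j; rewrite geq_max => /andP[/h1 j1 /h2 j2].
apply: part_norm_le => w hw; rewrite (pairing_restrictC (pred1 s)).
rewrite [e]splitr; apply: lerD.
  apply: le_trans j2; rewrite /restrict -filter_predI.
  rewrite (@eq_filter _ _ (fun tw => tw.1 == s)); last first.
    move=> tw /=; rewrite /at_above; case: eqP => //= ->.
    by rewrite Ps prefix_refl.
  exact: (pairing_point_le (u j) Ps hw).
apply: le_trans j1; apply: le_trans (part_norm_ub (above s) (u j) hw).
rewrite /restrict -filter_predI.
rewrite (@eq_filter _ _ (fun tw => above s tw.1)) //.
by move=> tw /=; rewrite /at_above /above andbC andbA.
Qed.

(** Arbitrarily large weights are allowed at sequences outside [P]. *)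
Lemma tree_space_out f t : ~~ P t -> f t = 0.
Proof.
move=> nPt; apply: scalar_abs_eq0; apply/eqP; rewrite eq_le scalar_abs_ge0 andbT.
rewrite leNgt; apply/negP => f0.
have h r : 0 <= r -> r * sabs (f t) <= wnorm f.
  move=> r0; have hw : weight [:: (t, r)].
    split; first by rewrite /nonneg_weight /= r0.
    move=> s Ps c; rewrite /along /=; case: ifP => ts.
      by rewrite (P_prefix ts Ps) in nPt.
    by rewrite /pairing big_nil branch_norm_ge0.
  have := @wnorm_ub _ _ _ (tree_weight_system k hp P) f _ hw.
  by rewrite /pairing big_seq1.
have N0 : 0 <= wnorm f by have := h 0 (lexx _); rewrite mul0r.
have := h _ (divr_ge0 (addr_ge0 N0 ler01) (scalar_abs_ge0 (f t))).
rewrite divfK; last by apply: lt0r_neq0.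
by rewrite gerDl ler10.
Qed.

Lemma wnorm_part f : wnorm f <= part_norm (at_above [::]) f.
Proof.
apply: wnorm_le => w hw; apply: le_trans (part_norm_ub _ _ hw).
rewrite (pairing_restrictC (at_above [::])).
rewrite [X in _ + X](_ : _ = 0) ?addr0 // /pairing big_filter big1 // => tw.
rewrite /= /at_above prefix0s andbT => /tree_space_out->.
by rewrite scalar_abs0 mulr0.
Qed.

Lemma cesaro_null_norm (u : nat -> space) : cesaro_null u ->
  forall e, 0 < e -> exists J, forall j, (J <= j)%N -> wnorm (u j) <= e.
Proof.
move=> hu e e0; have [J hJ] := cesaro_null_part hu P_nil e0.
by exists J => j /hJ; apply: le_trans (wnorm_part _).
Qed.

End TreeSpaceCesaro.

(** The factor of [b] bounds the l_p norm of [n] unimodular coefficients; it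
    grows like [n] to a power less than 1. *)
Lemma lp_growth_sublinear (R : realType) (p : \bar R) (b e : R) :
  (1%:E < p)%E -> 0 < b -> 0 < e -> exists2 n, (0 < n)%N &
  b * (match p with r%:E => n%:R `^ r^-1 | _ => 1 end) <= e * n%:R.
Proof.
move=> hp b0 e0; case: p hp => [r|h|h]; last by [].
  rewrite lte_fin => r1.
  have r0 : 0 < r by apply: lt_trans r1.
  have rn0 : r != 0 by apply: lt0r_neq0.
  pose al := 1 - r^-1.
  have al0 : 0 < al by rewrite subr_gt0 invf_lt1.
  have aln0 : al != 0 by apply: lt0r_neq0.
  have be0 : 0 <= b / e by rewrite divr_ge0 ?ltW.
  pose x := (b / e) `^ al^-1.
  have x0 : 0 <= x by apply: powR_ge0.
  exists (Num.bound x).+1 => //.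
  have xn : x <= (Num.bound x).+1%:R.
    by apply: le_trans (ltW (archi_boundP x0)) _; rewrite ler_nat leqnSn.
  set n := (Num.bound x).+1 in xn *.
  have n0 : n%:R != 0 :> R by rewrite pnatr_eq0.
  have nE : n%:R = n%:R `^ al * n%:R `^ r^-1 :> R.
    rewrite -powRD; last by rewrite n0 implybT.
    by rewrite /al subrK powRr1.
  rewrite [X in _ <= _ * X]nE mulrA ler_wpM2r ?powR_ge0 //.
  rewrite mulrC -ler_pdivrMr //.
  have -> : b / e = x `^ al by rewrite /x -powRrM mulVf // powRr1.
  by rewrite ge0_ler_powR ?nnegrE // ltW.
have be0 : 0 <= b / e by rewrite divr_ge0 ?ltW.
exists (Num.bound (b / e)).+1 => //.
rewrite mulr1 mulrC -ler_pdivrMr //.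
by apply: le_trans (ltW (archi_boundP be0)) _; rewrite ler_nat leqnSn.
Qed.

Lemma le_half_absurd (R : realFieldType) (a x : R) :
  1 <= a * x -> x * (a * 2) <= 1 -> False.
Proof. by nra. Qed.

Section NoSpreadingModel.
Variables (R : realType) (k : scalar_kind) (p : \bar R).
Hypothesis hp : (1%:E <= p)%E.
Variables (D : eqType) (P : pred (seq D)).
Hypothesis P_nil : P [::].
Hypothesis P_prefix : forall s t, prefix s t -> P t -> P s.
Hypothesis P_wf : well_founded (fun t s => [&& P t, prefix s t & t != s]).
Variables (S : ord -> set {fset nat}) (hS : schreier_families S).
Notation K := (scalar_field R k).
Notation space := (@tree_space R k p hp D P).

(** The upper estimate makes the sequence Cesàro-null, hence norm null, while
    the lower estimate bounds the norms of its terms from below. *)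
Lemma tree_space_no_spreading_model (u : nat -> space) :
  (1%:E < p)%E -> ~ spreading_model p (S oone) u.
Proof.
move=> p1 /spreading_model_seq[a [b [a0 b0 hu]]].
have unull : cesaro_null u.
  move=> e e0; have [n n0 hn] := lp_growth_sublinear p1 b0 e0.
  exists n, n; split=> // E sE szE ME c c1.
  have SE : S oone [fset i in E]%fset.
    by apply: (schreier1_of_seq hS n0) => //; rewrite szE.
  have [_ ub] := hu E sE SE c.
  rewrite -rnorm_wspace; apply: le_trans ub _; apply: le_trans hn.
  rewrite ler_wpM2l ?(ltW b0) // -szE; apply: lp_norm_ones => i _; exact: c1.
have [J hJ] := cesaro_null_norm P_nil P_prefix P_wf unull
  (divr_gt0 ltr01 (mulr_gt0 a0 (ltr0Sn _ 1))).
have SE : S oone [fset i in [:: J.+1]]%fset.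
  by apply: (@schreier1_of_seq _ hS J.+1); rewrite //= leqnn.
have [lb _] := hu [:: J.+1] isT SE (fun=> 1).
move: lb; rewrite (@lp_norm_single _ _ _ hp _ _ J.+1) ?mem_head //; last first.
  by move=> j; rewrite inE => /eqP->; rewrite eqxx.
rewrite scalar_abs1 /comb_norm big_seq1 scale1r rnorm_wspace => h.
have := hJ J.+1 (leqnSn J).
rewrite ler_pdivlMr ?mulr_gt0 // => h2.
exact: le_half_absurd h h2.
Qed.

End NoSpreadingModel.

(** * The case p = 1: a Ramsey argument along an ultrafilter *)

Section Prefixes.
Variable D : eqType.
Implicit Types (s t : seq D).

Definition prefixes s := [seq take i s | i <- iota 0 (size s).+1].

Lemma mem_prefixes s t : (t \in prefixes s) = prefix t s.
Proof.
apply/mapP/idP => [[i _ ->]|ts]; first exact: prefix_take.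
exists (size t); first by rewrite mem_iota /= add0n ltnS size_prefix.
by move: ts; rewrite prefixE => /eqP.
Qed.

Lemma prefixes_uniq s : uniq (prefixes s).
Proof.
rewrite map_inj_in_uniq ?iota_uniq // => i j; rewrite !mem_iota /= !add0n !ltnS.
by move=> is_ js /(congr1 size); rewrite !size_takel.
Qed.

Lemma prefix_comparable s t z : prefix s z -> prefix t z -> prefix s t || prefix t s.
Proof.
rewrite !prefixE => /eqP sz /eqP tz.
case: (leqP (size s) (size t)) => [st|/ltnW ts]; apply/orP.
  by left; rewrite -[X in take _ X]tz take_takel // sz.
by right; rewrite -[X in take _ X]sz take_takel // tz.
Qed.

Lemma prefix_extend s t : prefix s t -> t != s -> exists d, prefix (rcons s d) t.
Proof.
move=> /prefixP[[|d t'] ->]; first by rewrite cats0 eqxx.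
by move=> _; exists d; rewrite -cat_rcons prefix_prefix.
Qed.

End Prefixes.

Section UltraTree.
Variables (R : realType) (U : set_system nat).
Hypothesis UU : UltraFilter U.
Variables (D : eqType) (P : pred (seq D)).
Hypothesis P_nil : P [::].
Hypothesis P_prefix : forall s t, prefix s t -> P t -> P s.
Hypothesis P_wf : well_founded (fun t s => [&& P t, prefix s t & t != s]).
Implicit Types (s t : seq D).

Lemma ultra_notin (A : set nat) : ~ U A -> U (~` A).
Proof. by have [] := in_ultra_setVsetC A UU. Qed.

Lemma ultra_all (T : eqType) (r : seq T) (Q : T -> set nat) :
  (forall a, a \in r -> U (Q a)) -> U [set i | forall a, a \in r -> Q a i].
Proof.
elim: r => [|a r IH] h; first exact: filterE.
have ha := h a (mem_head _ _).
have hr : U [set i | forall b, b \in r -> Q b i].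
  by apply: IH => b br; apply: h; rewrite inE br orbT.
apply: filterS2 ha hr => i /= hai hri b.
by rewrite inE => /orP[/eqP->|/hri].
Qed.

(** Along [U] the branches ending in [sg i] converge to the branch of a node,
    because the tree has no infinite branch. *)
Lemma ultra_limit_node (sg : nat -> seq D) : U [set i | P (sg i)] ->
  exists2 g, P g & forall t, U [set i | prefix t (sg i) = prefix t g].
Proof.
move=> Psg.
have [g [Pg gU gmax]] : exists g, [/\ P g, U [set i | prefix g (sg i)] &
    forall d, ~ U [set i | prefix (rcons g d) (sg i)]].
  have : U [set i | prefix [::] (sg i)] by apply: filterE => i; exact: prefix0s.
  have := P_nil; move: [::]; elim/(well_founded_ind P_wf) => s IH Ps sU.
  have [[d dU]|h] := pselect (exists d, U [set i | prefix (rcons s d) (sg i)]).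
    have [i [/= Pi di]] := filter_ex (filterI Psg dU).
    apply: (IH (rcons s d)) => //; last exact: P_prefix di Pi.
    rewrite (P_prefix di Pi) prefix_rcons /=.
    by apply/eqP => /(congr1 size)/eqP; rewrite size_rcons (gtn_eqF (ltnSn _)).
  by exists s; split=> // d dU; apply: h; exists d.
exists g => // t; have [tg|ntg] := boolP (prefix t g).
  by apply: filterS gU => i /=; apply: prefix_trans.
have [tU|] := pselect (U [set i | prefix t (sg i)]); last first.
  by move=> /ultra_notin; apply: filterS => i /= /negP/negPf.
have [i [/= ti gi]] := filter_ex (filterI tU gU).
have := prefix_comparable ti gi; rewrite (negPf ntg) /= => gt.
have tg : t != g by apply: contraNneq ntg => ->; rewrite prefix_refl.
have [d dt] := prefix_extend gt tg.
by case: (gmax d); apply: filterS tU => j /=; apply: prefix_trans.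
Qed.

Variables (f : nat -> seq D -> R) (M : R).
Hypothesis f_ge0 : forall j t, 0 <= f j t.
Hypothesis f_sum : forall j E, uniq E -> \sum_(t <- E) f j t <= M.
Hypothesis f_lim : forall t e, 0 < e -> U [set j | f j t <= e].

Definition mass j s := \sum_(t <- prefixes s) f j t.

Lemma mass_bound j s : mass j s <= M.
Proof. exact/f_sum/prefixes_uniq. Qed.

Lemma sum_lim (E : seq (seq D)) e : 0 < e -> U [set j | \sum_(t <- E) f j t <= e].
Proof.
elim: E e => [|t E IH] e e0; first by apply: filterE => j /=; rewrite big_nil ltW.
have e2 : 0 < e / 2 by rewrite divr_gt0.
apply: filterS2 (f_lim t e2) (IH _ e2) => j /= h1 h2.
by rewrite big_cons [e]splitr lerD.
Qed.

Definition both_heavy eta j k :=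
  exists s, [/\ P s, eta < mass j s & eta < mass k s].

Lemma mass_split (A : pred (seq D)) j s : mass j s =
  \sum_(t <- [seq t <- prefixes s | A t]) f j t +
  \sum_(t <- [seq t <- prefixes s | ~~ A t]) f j t.
Proof. by rewrite /mass (bigID A) !big_filter. Qed.

(** A finite set whose sum is nearly the supremum leaves little elsewhere. *)
Lemma mass_tight j e : 0 < e -> exists2 E, uniq E &
  forall E', uniq E' -> \sum_(t <- [seq t <- E' | t \notin E]) f j t <= e.
Proof.
move=> e0; pose V := [set \sum_(t <- E) f j t | E in [set E : seq (seq D) | uniq E]].
have V0 : has_sup V.
  split; first by exists (\sum_(t <- [::]) f j t); exists [::].
  by exists M => _ [E uE <-]; apply: f_sum.
have [_ [E uE <-] hE] := sup_adherent e0 V0.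
exists E => // E' uE'.
have uEE' : uniq (E ++ [seq t <- E' | t \notin E]).
  rewrite cat_uniq uE filter_uniq // andbT; apply/hasPn => t.
  by rewrite mem_filter => /andP[].
have : \sum_(t <- E ++ [seq t <- E' | t \notin E]) f j t <= sup V.
  by apply: ub_le_sup; [case: V0|exists (E ++ [seq t <- E' | t \notin E])].
by rewrite big_cat /=; move: hE; lra.
Qed.

(** If heavy branches were shared by typical pairs, choose for each pair
    (j, k) such a branch and let [g j] be its limit in [k]. The limit branch
    still carries mass of [f j], so that infinitely many nodes [g j] are
    distinct. But two branches with different limits eventually meet inside
    a fixed finite set, where [f k] has no mass; hence for large [k] the
    function [f k] has mass on too many disjoint pieces. *)
Lemma ultra_not_both_heavy eta : 0 < eta ->
  U [set j | U [set k | ~ both_heavy eta j k]].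
Proof.
move=> eta0; apply: contrapT => /ultra_notin JU.
set J := ~` _ in JU.
have JP j : J j -> U [set k | both_heavy eta j k].
  by move=> /ultra_notin; apply: filterS => i; apply: contrapT.
have /choice[sg' sg'P] : forall jk : nat * nat, exists s, both_heavy eta jk.1 jk.2 ->
    [/\ P s, eta < mass jk.1 s & eta < mass jk.2 s].
  move=> jk; have [[s hs]|h] := pselect (both_heavy eta jk.1 jk.2); first by exists s.
  by exists [::].
pose sg j k := sg' (j, k).
have sgP j : J j -> U [set k | [/\ P (sg j k), eta < mass j (sg j k) &
    eta < mass k (sg j k)]].
  by move=> /JP; apply: filterS => i; apply: (sg'P (j, i)).
have /choice[g gP] : forall j, exists g, J j -> P g /\
    forall t, U [set k | prefix t (sg j k) = prefix t g].
  move=> j; have [Jj|nJj] := pselect (J j); last by exists [::].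
  have [|g Pg hg] := @ultra_limit_node (sg j); last by exists g.
  by apply: filterS (sgP j Jj) => i [].
have g_mass j : J j -> eta / 2 <= mass j (g j).
  move=> Jj; have [E uE hE] := mass_tight j (divr_gt0 eta0 (ltr0Sn _ 1)).
  have hU := ultra_all (r := E) (Q := fun t => [set k | prefix t (sg j k) = prefix t (g j)])
    (fun t _ => (gP j Jj).2 t).
  have [k [/= [_ hk _] kE]] := filter_ex (filterI (sgP j Jj) hU).
  have h1 := hE _ (prefixes_uniq (sg j k)).
  have h2 : \sum_(t <- [seq t <- prefixes (sg j k) | t \in E]) f j t <= mass j (g j).
    apply: ler_sum_support => //.
    - exact/filter_uniq/prefixes_uniq.
    - exact: prefixes_uniq.
    - move=> t; rewrite mem_filter mem_prefixes => /andP[tE ts] _.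
      by rewrite mem_prefixes -kE.
  have h3 := mass_split (fun t => t \in E) j (sg j k).
  by move: hk h1 h2; rewrite h3; lra.
have distinct m : exists js : seq nat, [/\ size js = m, forall j, j \in js -> J j &
    uniq [seq g j | j <- js]].
  elim: m => [|m [js [szm hJ ujs]]]; first by exists [::].
  have hU := ultra_all (r := js) (Q := fun i => [set j | mass j (g i) <= eta / 4])
    (fun i _ => sum_lim _ (divr_gt0 eta0 (ltr0Sn _ 3))).
  have [j [/= Jj hj]] := filter_ex (filterI JU hU).
  exists (j :: js); split; rewrite /= ?szm //.
    by move=> i; rewrite inE => /orP[/eqP->|/hJ].
  rewrite ujs andbT; apply/mapP => -[i ijs gij].
  have := g_mass j Jj; rewrite gij => h; have := le_trans h (hj i ijs).
  by move: eta0; lra.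
(* More than 2 M / eta disjoint pieces of mass eta / 2 are too many. *)
pose m := (Num.bound (2 * M / eta)).+1.
have [js [szm hJ ujs]] := distinct m.
pose L := undup (flatten [seq prefixes (g j) | j <- js]).
have memL j t : j \in js -> prefix t (g j) -> t \in L.
  move=> jjs tg; rewrite mem_undup; apply/flattenP.
  by exists (prefixes (g j)); [apply: map_f|rewrite mem_prefixes].
have meet_L a b : a \in js -> b \in js -> g a != g b ->
    U [set k | forall t, prefix t (sg a k) -> prefix t (sg b k) -> t \in L].
  wlog nab : a b / ~~ prefix (g a) (g b).
    move=> H ajs bjs gab; have [gab'|] := boolP (prefix (g a) (g b)); last first.
      by move=> nab; exact: (H a b nab ajs bjs gab).
    have nba : ~~ prefix (g b) (g a).
      apply: contra gab => gba; rewrite eq_sym.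
      by move: gab'; rewrite prefixE take_oversize // size_prefix.
    have := H b a nba bjs ajs; rewrite eq_sym => /(_ gab).
    by apply: filterS => k /= h t ta tb; apply: h.
  move=> ajs bjs _.
  have h1 := (gP a (hJ a ajs)).2 (g a).
  have h2 := (gP b (hJ b bjs)).2 (g a).
  apply: filterS2 h1 h2 => k /=; rewrite prefix_refl (negPf nab) => h1 h2 t ta tb.
  have /orP[|gt] := prefix_comparable ta h1; first exact: memL.
  by rewrite (prefix_trans gt tb) in h2.
have hU1 := ultra_all (r := js) (Q := fun a => [set k | [/\ P (sg a k),
  eta < mass a (sg a k) & eta < mass k (sg a k)]]) (fun a ha => sgP a (hJ a ha)).
have hU2 : U [set k | forall a, a \in js -> forall b, b \in js -> g a != g b ->
    forall t, prefix t (sg a k) -> prefix t (sg b k) -> t \in L].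
  apply: (ultra_all (Q := fun a => [set k | forall b, b \in js -> g a != g b ->
    forall t, prefix t (sg a k) -> prefix t (sg b k) -> t \in L])) => a ajs.
  apply: (ultra_all (Q := fun b => [set k | g a != g b ->
    forall t, prefix t (sg a k) -> prefix t (sg b k) -> t \in L])) => b bjs.
  have [gab|gab] := eqVneq (g a) (g b); first by apply: filterE.
  by apply: filterS (meet_L a b ajs bjs gab) => k /= h _.
have hU3 := sum_lim L (divr_gt0 eta0 (ltr0Sn _ 1)).
have [k [[/= k1 k2] k3]] := filter_ex (filterI (filterI hU1 hU2) hU3).
pose piece a := [seq t <- prefixes (sg a k) | t \notin L].
have piece_mass a : a \in js -> eta / 2 <= \sum_(t <- piece a) f k t.
  move=> ajs; have [_ _] := k1 a ajs.
  rewrite (mass_split (fun t => t \in L)) => h.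
  have : \sum_(t <- [seq t <- prefixes (sg a k) | t \in L]) f k t <= \sum_(t <- L) f k t.
    apply: ler_sum_support => //.
    - exact/filter_uniq/prefixes_uniq.
    - exact: undup_uniq.
    - by move=> t; rewrite mem_filter => /andP[].
  by move: h k3; rewrite /piece; lra.
have pieces : uniq (flatten [seq piece a | a <- js]) /\
    (size js)%:R * (eta / 2) <= \sum_(t <- flatten [seq piece a | a <- js]) f k t.
  have sub : {subset js <= js} by [].
  elim: {-2}(js) sub ujs => [|a r IH] sub ur; first by rewrite /= big_nil mul0r.
  have ajs : a \in js by apply: sub; rewrite mem_head.
  move: ur => /= /andP[ar ur].
  have [uF hF] := IH (fun b hb => sub b (mem_behead (s := a :: r) hb)) ur.
  split; last by rewrite big_cat /= -natr1 mulrDl mul1r addrC lerD // piece_mass.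
  rewrite cat_uniq uF andbT filter_uniq ?prefixes_uniq //=.
  apply/hasPn => t /flattenP[_ /mapP[b br ->]].
  rewrite mem_filter mem_prefixes => /andP[tL tb].
  apply/negP; rewrite mem_filter mem_prefixes => /andP[_ ta].
  have bjs : b \in js by apply: sub; rewrite inE br orbT.
  have gab : g a != g b by apply: contraNneq ar => ->; apply: map_f.
  by rewrite (k2 a ajs b bjs gab t ta tb) in tL.
have := le_trans pieces.2 (f_sum k pieces.1); rewrite szm.
have M0 : 0 <= M by have := @f_sum 0%N [::] isT; rewrite big_nil.
have : 2 * M / eta < m%:R.
  apply: lt_trans (archi_boundP _) _; last by rewrite ltr_nat.
  by apply: divr_ge0; [apply: mulr_ge0|exact: ltW].
rewrite ltr_pdivrMr //; lra.
Qed.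

(** Choose the indices one after the other, so that no branch is heavy for two
    of them; then on each branch one index contributes at most [M] and every
    other index at most [eta]. *)
Lemma sparse_indices (U_free : forall N, U [set j | (N <= j)%N]) eta N n : 0 < eta ->
  exists E : seq nat, [/\ sorted ltn E, size E = n, all (leq N) E &
    forall s, P s -> \sum_(j <- E) mass j s <= M + n%:R * eta].
Proof.
move=> eta0; have hU := ultra_not_both_heavy eta0.
have [E [sE szE NE hE]] : exists E, [/\ sorted (fun i j => (j < i)%N) E, size E = n,
    all (leq N) E & [/\ (forall i, i \in E -> U [set k | ~ both_heavy eta i k]) &
    (forall i j, i \in E -> j \in E -> i != j -> ~ both_heavy eta i j)]].
  elim: n => [|n [E [sE szE NE [hE1 hE2]]]]; first by exists [::].
  have h1 := ultra_all (r := E) (Q := fun i => [set k | ~ both_heavy eta i k]) hE1.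
  have h2 := U_free (maxn N (head 0%N E).+1).
  have [j [[/= j1 j2] j3]] := filter_ex (filterI (filterI hU h1) h2).
  move: j3; rewrite /= geq_max => /andP[jN jE].
  exists (j :: E); split; rewrite /= ?szE ?jN //.
    by case: E sE jE {szE NE hE1 hE2 h1 j2 h2} => //= a E -> ->.
  split=> [i|i i']; first by rewrite inE => /orP[/eqP->//|/hE1].
  rewrite !inE => /orP[/eqP->|iE] /orP[/eqP->|i'E]; rewrite ?eqxx // => ii'.
  - by case=> s [Ps h3 h4]; apply: (j2 i' i'E); exists s.
  - exact: j2.
  - exact: hE2.
exists (rev E); split.
- by rewrite rev_sorted.
- by rewrite size_rev.
- by rewrite all_rev.
move=> s Ps; rewrite (perm_big E) ?perm_rev //=.
have uE : uniq E.
  by apply: sorted_uniq sE => [x y z xy yz|x]; [exact: ltn_trans yz xy|exact: ltnn].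
have few (r : seq nat) : (forall j, j \in r -> mass j s <= eta) ->
    \sum_(j <- r) mass j s <= (size r)%:R * eta.
  move=> h; rewrite -sum1_size natr_sum mulr_suml big_seq [leRHS]big_seq.
  by apply: ler_sum => j jr; rewrite mul1r h.
have M0 : 0 <= M by have := @f_sum 0%N [::] isT; rewrite big_nil.
have [[j jE hj]|h] := pselect (exists2 j, j \in E & eta < mass j s); last first.
  apply: le_trans (few E _) _; last by rewrite szE lerDr.
  by move=> j jE; rewrite leNgt; apply/negP => hj; apply: h; exists j.
rewrite (big_rem j jE) /=; apply: lerD; first exact: mass_bound.
apply: le_trans (few _ _) _.
  move=> i; rewrite mem_rem_uniq // inE => /andP[ij iE].
  rewrite leNgt; apply/negP => hi; apply: (hE.2 i j iE jE ij).
  by exists s.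
by rewrite size_rem // szE ler_wpM2r ?(ltW eta0) // ler_nat leq_pred.
Qed.

End UltraTree.

Section TreeOperatorOne.
Variables (R : realType) (k : scalar_kind).
Hypothesis hp : (1%:E <= 1%:E :> \bar R)%E.
Variables (D : eqType) (P : pred (seq D)).
Hypothesis P_nil : P [::].
Hypothesis P_prefix : forall s t, prefix s t -> P t -> P s.
Hypothesis P_wf : well_founded (fun t s => [&& P t, prefix s t & t != s]).
Variables (S : ord -> set {fset nat}) (hS : schreier_families S).
Notation K := (scalar_field R k).
Notation sabs := (@scalar_abs R k).
Notation space := (@tree_space R k 1%:E hp D P).

Lemma lp_norm1 (E : seq nat) (c : nat -> K) :
  lp_norm 1%:E E c = \sum_(i <- E) sabs (c i).
Proof.
rewrite /lp_norm invr1 powRr1; last by apply: sumr_ge0 => i _; apply: powR_ge0.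
by apply: eq_bigr => i _; rewrite powRr1 // scalar_abs_ge0.
Qed.

Lemma branch_norm1 s (c : seq D -> K) :
  branch_norm 1%:E s c = \sum_(t <- prefixes s) sabs (c t).
Proof. by rewrite /branch_norm lp_norm1 big_map. Qed.

Lemma tree_norm1_sum (f : space) (E : seq (seq D)) : uniq E ->
  \sum_(t <- E) sabs (f t) <= wnorm f.
Proof.
move=> uE.
have hw : @tree_weights R k 1%:E D P [seq (t, 1) | t <- E].
  split; first by apply/allP => _ /mapP[v _ ->] /=; apply: ler01.
  move=> s _ c; rewrite branch_norm1 /pairing big_filter big_map /=.
  rewrite (eq_bigr (fun t => sabs (c t))) => [|t _]; last by rewrite mul1r.
  rewrite -big_filter; apply: ler_sum_support.
  - exact: filter_uniq.
  - exact: prefixes_uniq.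
  - by move=> t _; apply: scalar_abs_ge0.
  - by move=> t; rewrite mem_filter mem_prefixes => /andP[].
have := @wnorm_ub _ _ _ (tree_weight_system k hp P) f _ hw.
by rewrite /pairing big_map /=; under eq_bigr do rewrite mul1r.
Qed.

Lemma alternating_sum n : \sum_(i <- iota 0 n.*2) (-1) ^+ i = 0 :> K.
Proof.
elim: n => [|n IH]; first by rewrite big_nil.
rewrite doubleS -[n.*2.+2]addn2 iotaD big_cat /= IH add0r !big_cons big_nil.
by rewrite add0n exprS mulN1r addr0 subrr.
Qed.

(** Pass to a pointwise limit [z] along a free ultrafilter. Alternating signs
    remove [z], so the sum of [u] over a sparse set of indices has small mass
    on each branch, against the lower l_1 estimate for the images. *)
Lemma tree_operator_SM1 : SM_class 1%:E (S oone) (tree_operator k hp P_nil).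
Proof.
move=> u /spreading_model_seq[a [b [a0 b0 hu]]].
move=> /spreading_model_seq[a' [b' [a'0 b'0 hAu]]].
pose B := Num.max b (wnorm (u 0%N)).
have uB j : wnorm (u j) <= B.
  case: j => [|j]; first by rewrite le_max lexx orbT.
  have SE : S oone [fset i in [:: j.+1]]%fset.
    by apply: (@schreier1_of_seq _ hS j.+1); rewrite //= leqnn.
  have [_] := hu [:: j.+1] isT SE (fun=> 1).
  rewrite lp_norm1 big_seq1 scalar_abs1 mulr1 /comb_norm big_seq1 scale1r.
  by rewrite rnorm_wspace => h; rewrite le_max h.
have [U [UU FU]] := ultraFilterLemma (eventually_filter).
have U_free N : U [set j | (N <= j)%N] by apply: FU; exists N.
have /choice[z hz] : forall t, exists z, forall e, 0 < e ->
    U [set j | sabs (u j t - z) <= e].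
  move=> t; apply: (@ultra_scalar_lim _ _ UU _ _ _ B).
  by apply: filterE => j; apply: le_trans (wnorm_point (u j) t) (uB j).
pose f j t := sabs (u j t - z t).
have f0 j t : 0 <= f j t by apply: scalar_abs_ge0.
have z_sum (E : seq (seq D)) : uniq E -> \sum_(t <- E) sabs (z t) <= B.
  move=> uE; apply/ler_addgt0Pr => e e0.
  have [j hj] := filter_ex (sum_lim UU hz E e0).
  apply: le_trans (lerD (uB j) hj).
  apply: le_trans (lerD (tree_norm1_sum (u j) uE) (lexx _)).
  rewrite -big_split /=; apply: ler_sum => t _.
  by rewrite scalar_absB -{1}[z t](addrNK (u j t)) addrC ler_scalar_absD.
have f_sum j (E : seq (seq D)) : uniq E -> \sum_(t <- E) f j t <= B + B.
  move=> uE; apply: le_trans (lerD (uB j) (z_sum E uE)).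
  apply: le_trans (lerD (tree_norm1_sum (u j) uE) (lexx _)).
  rewrite -big_split /=; apply: ler_sum => t _.
  by rewrite -(scalar_absN (z t)) ler_scalar_absD.
(* With this [eta] and [2 m] indices, the lower estimate reads
   2 m <= a' (2 B + 2 m eta) = 2 a' B + m / 2. *)
pose eta := (4 * a')^-1.
have eta0 : 0 < eta by rewrite invr_gt0 mulr_gt0.
pose m := (Num.bound (a' * (B + B))).+1.
have [E [sE szE NE hE]] := sparse_indices UU P_nil P_prefix P_wf f0 f_sum hz
  U_free m.*2 m.*2 eta0.
pose c i : K := (-1) ^+ index i E.
have c1 i : sabs (c i) = 1.
  by apply: scalar_abs_eq; rewrite normrX normrN1 expr1n scalar_of_real1.
have uE : uniq E by apply: sorted_uniq sE; [exact: ltn_trans|exact: ltnn].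
have c_sum : \sum_(i <- E) c i = 0.
  transitivity (\sum_(i <- iota 0 m.*2) (-1) ^+ i : K); last exact: alternating_sum.
  rewrite -[in LHS](mkseq_nth 0%N E) big_map szE.
  apply: eq_big_seq => i; rewrite mem_iota /= => iE.
  by rewrite /c index_uniq // szE.
have SE : S oone [fset i in E]%fset.
  by apply: (@schreier1_of_seq _ hS m.*2) => //; rewrite szE.
have [lb _] := hAu E sE SE c; move: lb.
rewrite lp_norm1 (eq_bigr (fun=> 1)) => [|i _]; last exact: c1.
rewrite big_const_seq count_predT iter_addr addr0 szE => lb.
pose G : space := \sum_(i <- E) c i *: u i.
have combE : comb_norm (fun n => tree_operator k hp P_nil (u n)) E c =
    rnorm (tree_operator k hp P_nil G).
  rewrite /comb_norm /G linear_sum; congr rnorm.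
  by apply: eq_bigr => i _; rewrite linearZ.
have GE t : G t = \sum_(i <- E) c i * (u i t - z t).
  rewrite tree_space_sum; under [RHS]eq_bigr do rewrite mulrBr.
  by rewrite sumrB -mulr_suml c_sum mul0r subr0.
have ub : rnorm (tree_operator k hp P_nil G) <= B + B + m.*2%:R * eta.
  rewrite rnorm_wspace; apply: wnorm_le => w [hw [s Ps /allP ws]].
  apply: le_trans (hE s Ps).
  have -> : pairing w (tree_operator k hp P_nil G) = pairing (along s w) G.
    rewrite /pairing big_filter [RHS]big_mkcond; apply: eq_big_seq => tw tww.
    case: ifP => // ntw; have := ws tw tww; rewrite ntw implybF => nP.
    by rewrite -[LHS]/(tw.2 * sabs (G tw.1)) (tree_space_out P_prefix) // scalar_abs0 mulr0.
  apply: le_trans (hw.2 s Ps G) _; rewrite branch_norm1.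
  rewrite /mass exchange_big /=; apply: ler_sum => t _; rewrite GE.
  elim: (E) => [|i E' IH]; first by rewrite !big_nil scalar_abs0.
  rewrite !big_cons; apply: le_trans (ler_scalar_absD _ _) _.
  by rewrite scalar_absM c1 mul1r lerD2l.
have := le_trans lb (ler_wpM2l (ltW a'0) (_ : _ <= _)).
move=> /(_ (B + B + m.*2%:R * eta)); rewrite combE => /(_ ub).
have e1 : a' * eta = 4^-1.
  by rewrite /eta invfM mulrCA mulfV ?mulr1 // lt0r_neq0.
have m1 : a' * (B + B) < m%:R.
  apply: lt_trans (archi_boundP _) _; last by rewrite ltr_nat.
  apply: mulr_ge0; first exact: ltW.
  by apply: addr_ge0; rewrite le_max (ltW b0).
have m0 : 0 <= m%:R :> R by [].
rewrite mulrDr mulrCA e1 -mul2n natrM.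
by move: m0 m1; lra.
Qed.

End TreeOperatorOne.

(** * A well-founded tree of prescribed rank *)

(** Positions in the term [x]. They stand for the ordinals below [x], but form
    a type in the universe of the index types of suprema, whereas [ord] itself
    is too large to index a Banach space. *)
Fixpoint below (x : ord) : Type :=
  match x with
  | ozero => void
  | osucc x' => option (below x')
  | osup J _ f => {i : J & below (f i)}
  end.

Fixpoint below_val (x : ord) : below x -> ord :=
  match x with
  | ozero => fun d => match d with end
  | osucc x' => fun d => if d is Some d' then below_val d' else x'
  | osup J _ f => fun d => below_val (projT2 d)
  end.

Lemma below_valP x y : olt y x -> exists d : below x, oeq (below_val d) y.
Proof.
elim: x => [|x IH|I i0 f IH] //=.
- move=> yx; case: (ole_or_olt x y) => [xy|yx'].
    by exists None.
  by have [d hd] := IH yx'; exists (Some d).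
- by move=> [i /IH[d hd]]; exists (existT _ i d).
Qed.

Section DecreasingTree.
Variable x : ord.

Definition below_gt : rel {classic (below x)} :=
  fun d e => `[< olt (below_val (e : below x)) (below_val (d : below x)) >].

Lemma below_gt_trans : transitive below_gt.
Proof.
move=> e d g /asboolP de /asboolP eg; apply/asboolP.
exact: olt_ole_trans eg (oltW de).
Qed.

Definition decreasing : pred (seq {classic (below x)}) := sorted below_gt.

Lemma decreasing_prefix s t : prefix s t -> decreasing t -> decreasing s.
Proof. by move=> /prefixP[t' ->] /cat_sorted2[]. Qed.

Lemma decreasing_wf :
  well_founded (fun t s => [&& decreasing t, prefix s t & t != s]).
Proof.
have h o : forall d s, below_val (last d s : below x) = o ->
    Acc (fun t s => [&& decreasing t, prefix s t & t != s]) (d :: s).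
  elim/(well_founded_ind olt_wf): o => o IH d s so; constructor=> t.
  case/and3P=> dt /prefixP[[|e t'] tE] ts.
    by rewrite tE cats0 eqxx in ts.
  rewrite {t ts}tE cat_cons in dt *; apply: (IH _ _ _ _ erefl).
  rewrite -so last_cat /=; apply/asboolP.
  move: dt; rewrite /decreasing /= cat_path => /andP[_].
  by move=> /(order_path_min below_gt_trans)/allP; apply; exact: mem_last.
case=> [|d s]; last exact: h erefl.
by constructor=> -[|d s]; [rewrite eqxx andbF|move=> _; exact: h erefl].
Qed.

(** A decreasing sequence survives as many derivations as its last term; the
    empty sequence survives [x] of them. *)
Lemma decreasing_rank : tree_deriv_iter [set s | decreasing s] x [::].
Proof.
pose bound (s : seq {classic (below x)}) :=
  if s is d :: s' then below_val (last d s' : below x) else x.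
have below_lt y : forall d : below y, olt (below_val d) y.
  elim: y => [|y IH|I i0 f IH] //=.
  - by case=> [d|]; [exact: oltW (IH d)|exact: ole_refl].
  - by case=> i d; exists i; exact: IH.
have bound_le s : ole (bound s) x.
  by case: s => [|d s]; [exact: ole_refl|exact: oltW (below_lt _ _)].
suff h al s : decreasing s -> ole al (bound s) ->
    tree_deriv_iter [set s | decreasing s] al s by apply: h => //; exact: ole_refl.
elim: al s => [|al IH|I i0 f IH] s ds; first by [].
- move=> als; have [d [hd1 hd2]] := below_valP (olt_ole_trans als (bound_le s)).
  apply/tree_derivP; split; first by apply: IH => //; exact: oltW.
  exists (rcons s (d : {classic (below x)})); last first.
    split; first exact: prefix_rcons.
    by move=> /(congr1 size)/eqP; rewrite size_rcons (gtn_eqF (ltnSn _)).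
  apply: IH; last by case: s {ds als} => //= e s; rewrite last_rcons.
  case: s ds als => //= e s ds als; rewrite /decreasing /= rcons_path ds /=.
  by apply/asboolP; apply: (@ole_trans (osucc al)).
- by move=> als i _; apply: IH.
Qed.

End DecreasingTree.

(** * Inclusions and non-inclusions between the classes *)

Theorem theorem7p3 (R : realType) (k : scalar_kind) (p : \bar R)
    (hp : (1%:E <= p)%E)
    (S : ord -> set {fset nat}) (hS : schreier_families S) :
  (forall x : ord, olt ozero x -> ole x omega1 ->
     @proper_subclass R k (NP_class p x) (SM_class p (S x))) /\
  (forall x : ord, olt ozero x ->
     ~ @subclass R k (SM_class p (S oone)) (NP_class p x)).
Proof.
have part2 x : ~ @subclass R k (SM_class p (S oone)) (NP_class p x).
  have wf := @decreasing_wf (omega_pow x).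
  have pre := @decreasing_prefix (omega_pow x).
  have nil : @decreasing (omega_pow x) [::] by [].
  move=> sub; apply: (@tree_operator_not_NP R k p hp _ _ nil pre _ (decreasing_rank _)).
  apply: sub; have [p1|p1] : 1%:E = p \/ (1%:E < p)%E.
    by have := hp; rewrite le_eqVlt => /orP[/eqP|]; [left|right].
  - by subst p; exact: (tree_operator_SM1 (hp := hp) (P_nil := nil) pre wf hS).
  - by move=> u /(tree_space_no_spreading_model nil pre wf hS p1).
split=> [x x0 xw|x _]; last exact: part2.
split; first exact: NP_class_sub_SM_class.
move=> sub; apply: (part2 x) => X Y A /(SM_class1_sub hS x0 xw); exact: sub.
Qed.
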